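(* If $X$ and $Y$ are connected CW-complexes, each of which is locally finite or countable, then $AC(X\times Y)\leq AC(X)+AC(Y)$.
   Context: A CW-complex is locally finite if every point is contained in a finite number of (closed) cells, and countable if it has countably many cells. For a path connected, locally path connected and semilocally simply connected space $X$ (for example a connected CW-complex), an open subset $U\subseteq X$ is nice if it is path connected and the inclusion induces the trivial map $\pi_1(U,x)\to\pi_1(X,x)$ for every $x\in U$; the nice open sets form a basis of the topology. Let $I=[0,1]$ and let $X^I$ be the space of all continuous paths $I\to X$ with the compact-open topology. $\Pi(X)$ is the set of homotopy classes relative to endpoints $[\gamma]$ of paths $\gamma:I\to X$, with the topology having as basis the sets $S(U,V,[\gamma])=\{[\delta_1*\gamma*\delta_2]\}$, where $U,V\subseteq X$ are nice open sets, $\gamma$ is a path with $\gamma(0)\in U$ and $\gamma(1)\in V$, and $\delta_1$ (resp. $\delta_2$) ranges over the paths contained in $U$ ending at $\gamma(0)$ (resp. contained in $V$ starting at $\gamma(1)$); $*$ is concatenation. Let $q:X^I\to\Pi(X)$ be the quotient map $q(\gamma)=[\gamma]$. The (normalized) asphericity complexity $AC(X)$ is the minimum integer $k\ge 0$ such that $\Pi(X)$ can be covered by open subsets $U_0,\dots,U_k$, each admitting a continuous map $s_j:U_j\to X^I$ with $q\circ s_j$ equal to the inclusion $U_j\hookrightarrow\Pi(X)$ ($AC(X)=\infty$ if there is no such $k$). *)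

(* Defs.v *)
From HB Require Import structures.
From mathcomp Require Import all_boot all_order all_algebra finmap generic_quotient.
From mathcomp Require Import all_classical all_reals all_analysis.
From mathcomp Require Import lra.

Set Implicit Arguments.
Unset Strict Implicit.
Unset Printing Implicit Defensive.

Import Order.TTheory GRing.Theory Num.Theory.
Import numFieldNormedType.Exports.

Local Open Scope classical_set_scope.
Local Open Scope ring_scope.

Section cw.
Context {R : realType}.

(* The standard topology of 'rV[R]_n is the Euclidean one although the library
   norm is the sup norm, so the discs are cut out by the sum of squares. *)
Definition disc n : set 'rV[R]_n := [set x | \sum_(i < n) x ord0 i ^+ 2 <= 1].
Definition open_disc n : set 'rV[R]_n :=
  [set x | \sum_(i < n) x ord0 i ^+ 2 < 1].
Definition sphere n : set 'rV[R]_n :=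
  [set x | \sum_(i < n) x ord0 i ^+ 2 = 1].

End cw.

(* Whitehead's definition: a partition of a Hausdorff space into open cells
   with characteristic maps, which is closure-finite and has the weak topology.
   Only the values of [cw_map a] on [disc (cw_dim a)] matter. *)
Record cw_complex (R : realType) (X : topologicalType) := CWComplex {
  cw_cell : Type;
  cw_dim : cw_cell -> nat;
  cw_map : forall a : cw_cell, 'rV[R]_(cw_dim a) -> X;
  open_cell (a : cw_cell) : set X := @cw_map a @` @open_disc R (cw_dim a);
  closed_cell (a : cw_cell) : set X := closure (open_cell a);
  cw_hausdorff : hausdorff_space X;
  cw_cover : forall x : X, exists a, open_cell a x;
  cw_disjoint : forall a b x, open_cell a x -> open_cell b x -> a = b;
  cw_map_continuous : forall a,
    {within @disc R (cw_dim a), continuous (@cw_map a)};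
  (* The next two fields: [cw_map a] restricts to a homeomorphism from the open
     disc onto the open cell. *)
  cw_map_inj : forall a, {in @open_disc R (cw_dim a) &, injective (@cw_map a)};
  cw_map_open : forall a (W : set 'rV[R]_(cw_dim a)),
    open W -> W `<=` @open_disc R (cw_dim a) ->
    exists2 O : set X, open O & @cw_map a @` W = O `&` open_cell a;
  cw_closure_finite : forall a, exists F : set cw_cell,
    [/\ finite_set F, forall b, F b -> (cw_dim b < cw_dim a)%N &
        @cw_map a @` @sphere R (cw_dim a) `<=` \bigcup_(b in F) open_cell b];
  cw_weak_topology : forall A : set X,
    (forall a, closed (A `&` closed_cell a)) -> closed A
}.

Definition locally_finite_cw (R : realType) (X : topologicalType)
    (K : cw_complex R X) :=
  forall x : X, finite_set [set a : cw_cell K | closed_cell a x].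

Definition countable_cw (R : realType) (X : topologicalType)
    (K : cw_complex R X) :=
  countable [set: cw_cell K].

Section glue.
Context {R : realType} {T X : topologicalType}.
Variables (h : T -> R) (c : R) (f g : T -> X).

Lemma continuous_glue : continuous h -> continuous f -> continuous g ->
  (forall t, h t = c -> f t = g t) ->
  continuous (fun t => if h t <= c then f t else g t).
Proof.
move=> ch cf cg fg; set k := (X in continuous X).
pose A := h @^-1` [set x | x <= c]; pose B := h @^-1` [set x | c <= x].
have cA : closed A by apply: preimage_closed => //; exact: closed_le.
have cB : closed B by apply: preimage_closed => //; exact: closed_ge.
have AB : A `|` B = setT.
  by rewrite -subTset => t _ /=; case: (leP (h t) c) => [|/ltW]; [left|right].
apply/continuous_subspace_setT; rewrite -AB.
apply: withinU_continuous => //.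
- apply: (@subspace_eq_continuous _ A _ f); last exact: continuous_subspaceT.
  by move=> t; rewrite inE /= /from_subspace /k => At; rewrite ifT.
- apply: (@subspace_eq_continuous _ B _ g); last exact: continuous_subspaceT.
  move=> t; rewrite inE /= /from_subspace /k => ct; case: ifPn => // tc.
  by rewrite fg //; apply/le_anti/andP.
Qed.

End glue.

Section affine.
Context {R : realType} {T : topologicalType}.
Variables (a : T -> R) (ca : continuous a).

Lemma continuous_double : continuous (fun t => 2 * a t).
Proof. by move=> t; apply: cvgM; [exact: cvg_cst|exact: ca]. Qed.

Lemma continuous_subl (c : R) : continuous (fun t => c - a t).
Proof. by move=> t; apply: cvgB; [exact: cvg_cst|exact: ca]. Qed.

Lemma continuous_subr (c : R) : continuous (fun t => a t - c).
Proof. by move=> t; apply: cvgB; [exact: ca|exact: cvg_cst]. Qed.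

End affine.

Lemma continuous_pair {T U V : topologicalType} (a : T -> U) (b : T -> V) :
  continuous a -> continuous b -> continuous (fun t => (a t, b t)).
Proof. by move=> ca cb t; apply: cvg_pair; [exact: ca|exact: cb]. Qed.

Section unit_interval.
Context (R : realType).

Definition unit_interval : Type := set_type `[(0 : R), 1]%classic.

HB.instance Definition _ := Topological.on unit_interval.

Lemma to_unit_subproof (r : R) :
  Num.max 0 (Num.min 1 r) \in `[(0 : R), 1]%classic.
Proof.
by rewrite inE /= in_itv /= le_max lexx ge_max ler01 ge_min lexx.
Qed.

(* Only the values on [0, 1] matter; this total version avoids carrying bounds. *)
Definition to_unit (r : R) : unit_interval :=
  exist (fun x => x \in `[(0 : R), 1]%classic) _ (to_unit_subproof r).

Lemma to_unitE (r : R) : \val (to_unit r) = Num.max 0 (Num.min 1 r).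
Proof. by []. Qed.

Lemma unit_val_continuous : continuous (\val : unit_interval -> R).
Proof. exact: initial_continuous. Qed.

Lemma to_unit_continuous : continuous to_unit.
Proof.
move=> x; apply: (@continuous_comp_initial _ _ _ (set_val : unit_interval -> R)).
move=> {}x; rewrite (_ : _ \o _ = (fun=> 0) \max ((fun=> 1) \min id))//.
by apply: continuous_max; [exact: cst_continuous|
  apply: continuous_min; [exact: cst_continuous|]].
Qed.

Lemma unit_zero_one_neq : to_unit 0 != to_unit 1.
Proof.
apply/eqP => /(congr1 (\val : unit_interval -> R)); rewrite !to_unitE.
by rewrite minxx (min_idPr ler01) maxxx (max_idPr ler01) => /esym/eqP; rewrite oner_eq0.
Qed.

HB.instance Definition _ :=
  isBiPointed.Build unit_interval unit_zero_one_neq.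

Lemma unit_val0 : \val (zero : unit_interval) = 0.
Proof. by rewrite to_unitE (min_idPr ler01) maxxx. Qed.

Lemma unit_val1 : \val (one : unit_interval) = 1.
Proof. by rewrite to_unitE minxx (max_idPr ler01). Qed.

Lemma unit_val_itv (t : unit_interval) : 0 <= \val t <= 1.
Proof. by have := valP t; rewrite inE /= in_itv. Qed.

Lemma to_unitK (t : unit_interval) : to_unit (\val t) = t.
Proof.
apply: val_inj; have /andP[t0 t1] := unit_val_itv t.
by rewrite to_unitE (min_idPr t1) (max_idPr t0).
Qed.

End unit_interval.

Section paths.
Context (R : realType) (X : topologicalType).
Local Notation I := (unit_interval R).

Definition path_space : Type := continuousType I X.

HB.instance Definition _ := Choice.on path_space.
HB.instance Definition _ := Topological.copy path_space
  (initial_topology (id : continuousType I X -> {compact-open, I -> X})).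

Implicit Types f g k : path_space.

Definition fun_of_path (f : path_space) : I -> X := (f : continuousType I X).
Coercion fun_of_path : path_space >-> Funclass.

Lemma path_continuous f : continuous f.
Proof. exact: cts_fun. Qed.

Definition mkpath (f : I -> X) (cf : continuous f) : path_space :=
  mkcts cf : continuousType I X.

Definition concat_fun (f g : I -> X) : I -> X := fun t =>
  if \val t <= 1 / 2 then f (to_unit (2 * \val t))
  else g (to_unit (2 * \val t - 1)).

Lemma concat_continuous f g : f one = g zero -> continuous (concat_fun f g).
Proof.
move=> fg.
have c2 : continuous (fun t : I => 2 * \val t).
  exact/continuous_double/unit_val_continuous.
apply: (continuous_glue (unit_val_continuous (R := R))).
- move=> t; apply: (@continuous_comp _ _ _ (fun t : I => to_unit (2 * \val t)) f);
    last exact: path_continuous.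
  apply: (@continuous_comp _ _ _ (fun t : I => 2 * \val t) (@to_unit R));
    [exact: c2|exact: to_unit_continuous].
- move=> t; apply: (@continuous_comp _ _ _ (fun t : I => to_unit (2 * \val t - 1)) g);
    last exact: path_continuous.
  apply: (@continuous_comp _ _ _ (fun t : I => 2 * \val t - 1) (@to_unit R));
    [exact: (continuous_subr c2)|exact: to_unit_continuous].
- move=> t ->; rewrite mulrCA divff ?mulr1 ?pnatr_eq0// subrr.
  exact: fg.
Qed.

(* Junk value [f] when the paths are not composable. *)
Definition concat f g : path_space :=
  if pselect (f one = g zero) is left fg then mkpath (concat_continuous fg)
  else f.

Definition homotopic f g :=
  exists2 H : I * I -> X, continuous H &
    [/\ forall s, H (s, zero) = f s, forall s, H (s, one) = g s,
        forall t, H (zero, t) = f zero & forall t, H (one, t) = f one].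

Definition homotopicb f g : bool := `[< homotopic f g >].

Lemma homotopicb_refl : reflexive homotopicb.
Proof.
move=> f; apply/asboolP; exists (f \o fst); last by split.
by move=> p; apply: continuous_comp; [exact: cvg_fst|exact: path_continuous].
Qed.

Lemma snd_val_continuous : continuous (fun p : I * I => \val p.2).
Proof.
move=> p; apply: (@continuous_comp _ _ _ (@snd I I) (\val : I -> R)).
  exact: cvg_snd.
exact: unit_val_continuous.
Qed.

Lemma reparam_continuous (a : I * I -> R) (G : I * I -> X) :
  continuous a -> continuous G -> continuous (fun p => G (p.1, to_unit (a p))).
Proof.
move=> ca cG p; apply: (@continuous_comp _ _ _
  (fun p : I * I => (p.1, to_unit (a p))) G); last exact: cG.
apply: (continuous_pair (a := @fst I I)); first by move=> q; exact: cvg_fst.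
by move=> q; apply: (@continuous_comp _ _ _ a (@to_unit R));
  [exact: ca|exact: to_unit_continuous].
Qed.

Lemma homotopic_sym f g : homotopic f g -> homotopic g f.
Proof.
case=> H cH [H0 H1 Hz Ho].
exists (fun p => H (p.1, to_unit (1 - \val p.2))).
  by apply: reparam_continuous => //; exact/continuous_subl/snd_val_continuous.
have g0 : g zero = f zero by rewrite -H1 Hz.
have g1 : g one = f one by rewrite -H1 Ho.
split=> [s|s|t|t].
- by rewrite -[LHS]/(H (s, to_unit (1 - \val (zero : I)))) unit_val0 subr0 H1.
- by rewrite -[LHS]/(H (s, to_unit (1 - \val (one : I)))) unit_val1 subrr H0.
- by rewrite Hz g0.
- by rewrite Ho g1.
Qed.

Lemma homotopicb_sym : symmetric homotopicb.
Proof. by move=> f g; apply/asboolP/asboolP; exact: homotopic_sym. Qed.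

Lemma homotopicb_trans : transitive homotopicb.
Proof.
move=> g f k /asboolP[H cH [H0 H1 Hz Ho]] /asboolP[K cK [K0 K1 Kz Ko]].
have g0 : g zero = f zero by rewrite -H1 Hz.
have g1 : g one = f one by rewrite -H1 Ho.
apply/asboolP; exists (fun p => if \val p.2 <= 1 / 2
    then H (p.1, to_unit (2 * \val p.2))
    else K (p.1, to_unit (2 * \val p.2 - 1))).
  have c2 := continuous_double snd_val_continuous.
  apply: (continuous_glue snd_val_continuous).
  - exact: reparam_continuous.
  - by apply: reparam_continuous => //; exact: continuous_subr.
  - move=> p ->; rewrite mulrCA divff ?mulr1 ?pnatr_eq0// subrr.
    by rewrite H1 K0.
split=> [s|s|t|t].
- rewrite -[LHS]/(if \val (zero : I) <= 1 / 2
    then H (s, to_unit (2 * \val (zero : I)))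
    else K (s, to_unit (2 * \val (zero : I) - 1))).
  by rewrite unit_val0 ifT ?mulr0 ?H0//; lra.
- rewrite -[LHS]/(if \val (one : I) <= 1 / 2
    then H (s, to_unit (2 * \val (one : I)))
    else K (s, to_unit (2 * \val (one : I) - 1))).
  rewrite unit_val1 ifF; last by apply/negbTE; rewrite -ltNge; lra.
  by rewrite (_ : 2 * 1 - 1 = 1 :> R) ?K1//; lra.
- by rewrite /= Hz Kz g0; case: ifP.
- by rewrite /= Ho Ko g1; case: ifP.
Qed.

Canonical homotopic_equiv_rel :=
  EquivRel homotopicb homotopicb_refl homotopicb_sym homotopicb_trans.

Local Open Scope quotient_scope.

Definition Pi : Type := {eq_quot homotopic_equiv_rel}.

HB.instance Definition _ := EqQuotient.on Pi.
HB.instance Definition _ := Choice.on Pi.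

Definition path_class (f : path_space) : Pi := \pi_Pi f.

Lemma path_classP f g : path_class f = path_class g <-> homotopic f g.
Proof.
split=> [/eqmodP/asboolP//|fg]; exact/eqmodP/asboolP.
Qed.

Definition path_in (U : set X) f := forall t : I, U (f t).

Definition path_connected (U : set X) :=
  forall x y, U x -> U y ->
    exists f, [/\ path_in U f, f zero = x & f one = y].

Definition const_path (x : X) : path_space := mkpath (@cst_continuous I X x).

(* The last condition says that pi_1(U, x) -> pi_1(X, x) is trivial: the class
   of every loop of U at x is the neutral element of pi_1(X, x). *)
Definition nice (U : set X) :=
  [/\ open U, path_connected U &
      forall x, U x -> forall f, path_in U f -> f zero = x -> f one = x ->
        homotopic f (const_path x)].

Definition Pi_basic (U V : set X) (f : path_space) : set Pi :=
  [set p | exists d1 d2 : path_space,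
    [/\ path_in U d1, d1 one = f zero, path_in V d2, d2 zero = f one &
        p = path_class (concat (concat d1 f) d2)]].

Definition Pi_basis : set (set Pi) :=
  [set S | exists U V f,
    [/\ nice U, nice V, U (f zero), V (f one) & S = Pi_basic U V f]].

(* A subbase, so that [Pi] is a topological space for every [X]; it is a basis
   whenever the nice open sets form a basis of [X]: see [basis_Pi_basis]. *)
HB.instance Definition _ := isSubBaseTopological.Build Pi Pi_basis id.

Lemma concatE f g : f one = g zero -> concat f g =1 concat_fun f g.
Proof. by rewrite /concat; case: pselect. Qed.

Lemma concat0 f g : f one = g zero -> concat f g zero = f zero.
Proof.
move=> fg; rewrite concatE// /concat_fun unit_val0 ifT ?mulr0//; lra.
Qed.

Lemma concat1 f g : f one = g zero -> concat f g one = g one.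
Proof.
move=> fg; rewrite concatE// /concat_fun unit_val1 ifF.
  by rewrite (_ : 2 * 1 - 1 = 1 :> R)//; lra.
by apply/negbTE; rewrite -ltNge; lra.
Qed.

Lemma homotopic_ends f g : homotopic f g -> f zero = g zero /\ f one = g one.
Proof. by case=> H _ [_ H1 Hz Ho]; rewrite -!H1 Hz Ho. Qed.

Lemma homotopic_refl f : homotopic f f.
Proof. by apply/asboolP; exact: homotopicb_refl. Qed.

Lemma homotopic_trans g f k : homotopic f g -> homotopic g k -> homotopic f k.
Proof.
by move=> /asboolP fg /asboolP gk; apply/asboolP; exact: homotopicb_trans gk.
Qed.

Lemma fst_val_continuous : continuous (fun p : I * I => \val p.1).
Proof.
move=> p; apply: (@continuous_comp _ _ _ (@fst I I) (\val : I -> R)).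
  exact: cvg_fst.
exact: unit_val_continuous.
Qed.

Lemma reparam_continuous1 (a : I * I -> R) (G : I * I -> X) :
  continuous a -> continuous G -> continuous (fun p => G (to_unit (a p), p.2)).
Proof.
move=> ca cG p; apply: (@continuous_comp _ _ _
  (fun p : I * I => (to_unit (a p), p.2)) G); last exact: cG.
apply: (continuous_pair (b := @snd I I)); last by move=> q; exact: cvg_snd.
by move=> q; apply: (@continuous_comp _ _ _ a (@to_unit R));
  [exact: ca|exact: to_unit_continuous].
Qed.

Lemma homotopic_concat f f' g g' : f one = g zero ->
  homotopic f f' -> homotopic g g' -> homotopic (concat f g) (concat f' g').
Proof.
move=> fg ff' gg'; have [f0 f1] := homotopic_ends ff'.
have [g0 g1] := homotopic_ends gg'.
have fg' : f' one = g' zero by rewrite -f1 -g0.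
case: ff' => H cH [H0 H1 Hz Ho]; case: gg' => K cK [K0 K1 Kz Ko].
exists (fun p => if \val p.1 <= 1 / 2
    then H (to_unit (2 * \val p.1), p.2)
    else K (to_unit (2 * \val p.1 - 1), p.2)).
  have c2 := continuous_double fst_val_continuous.
  apply: (continuous_glue fst_val_continuous).
  - exact: reparam_continuous1.
  - by apply: reparam_continuous1 => //; exact: continuous_subr.
  - move=> p ->; rewrite mulrCA divff ?mulr1 ?pnatr_eq0// subrr.
    by rewrite Ho Kz.
split=> [s|s|t|t].
- by rewrite concatE// /concat_fun -H0 -K0.
- by rewrite concatE// /concat_fun -H1 -K1.
- rewrite concat0// -[LHS]/(if \val (zero : I) <= 1 / 2
    then H (to_unit (2 * \val (zero : I)), t)
    else K (to_unit (2 * \val (zero : I) - 1), t)).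
  by rewrite unit_val0 ifT ?mulr0 ?Hz//; lra.
- rewrite concat1// -[LHS]/(if \val (one : I) <= 1 / 2
    then H (to_unit (2 * \val (one : I)), t)
    else K (to_unit (2 * \val (one : I) - 1), t)).
  rewrite unit_val1 ifF; last by apply/negbTE; rewrite -ltNge; lra.
  by rewrite (_ : 2 * 1 - 1 = 1 :> R) ?Ko//; lra.
Qed.

Lemma homotopic_reparam f g (a : R -> R) : continuous a ->
  to_unit (a 0) = zero -> to_unit (a 1) = one ->
  (forall s : I, g s = f (to_unit (a (\val s)))) -> homotopic g f.
Proof.
move=> ca a0 a1 gE.
pose b (p : I * I) : R :=
  \val (to_unit (a (\val p.1))) + \val p.2 * (\val p.1 - \val (to_unit (a (\val p.1)))).
have cta : continuous (fun p : I * I => \val (to_unit (a (\val p.1)))).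
  move=> p; apply: (@continuous_comp _ _ _ (fun p : I * I => a (\val p.1))
    (fun x => \val (to_unit x))).
    apply: (@continuous_comp _ _ _ (fun p : I * I => \val p.1) a); last exact: ca.
    exact: fst_val_continuous.
  apply: (@continuous_comp _ _ _ (@to_unit R) (\val : I -> R)).
    exact: to_unit_continuous.
  exact: unit_val_continuous.
have cb : continuous b.
  move=> p; apply: (continuousD (cta p)); apply: continuousM.
    exact: snd_val_continuous.
  by apply: continuousB; [exact: fst_val_continuous|exact: cta].
exists (fun p => f (to_unit (b p))).
  move=> p; apply: (@continuous_comp _ _ _ (fun p => to_unit (b p)) f);
    last exact: path_continuous.
  by apply: (@continuous_comp _ _ _ b (@to_unit R)); [exact: cb|
    exact: to_unit_continuous].
split=> [s|s|t|t]; rewrite ?gE /b.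
- by rewrite -[(s, zero).2]/(zero : I) -[(s, zero).1]/s unit_val0 mul0r addr0 to_unitK.
- by rewrite -[(s, one).2]/(one : I) -[(s, one).1]/s unit_val1 mul1r addrC subrK to_unitK.
- by rewrite -[(zero, t).1]/(zero : I) unit_val0 a0 unit_val0 subr0 mulr0 addr0.
- by rewrite -[(one, t).1]/(one : I) unit_val1 a1 unit_val1 subrr mulr0 addr0.
Qed.

Lemma to_unit_id (x : R) : 0 <= x <= 1 -> \val (to_unit x) = x.
Proof. by case/andP=> x0 x1; rewrite to_unitE (min_idPr x1) (max_idPr x0). Qed.

Lemma to_unit_le0 (x : R) : x <= 0 -> to_unit x = zero.
Proof.
move=> x0; apply: val_inj; rewrite unit_val0 to_unitE (min_idPr _) ?(max_idPl x0)//.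
by apply: le_trans x0 _.
Qed.

Lemma to_unit_ge1 (x : R) : 1 <= x -> to_unit x = one.
Proof.
by move=> x1; apply: val_inj; rewrite unit_val1 to_unitE (min_idPl x1) (max_idPr ler01).
Qed.

Lemma homotopic_const_l f : homotopic (concat (const_path (f zero)) f) f.
Proof.
apply: (@homotopic_reparam _ _ (fun x => 2 * x - 1)).
- move=> x; apply: cvgB; last exact: cvg_cst.
  by apply: cvgM; [exact: cvg_cst|exact: cvg_id].
- by apply: to_unit_le0; lra.
- by apply: to_unit_ge1; lra.
- move=> s; rewrite concatE// /concat_fun; case: ifPn => // s2.
  by rewrite -[LHS]/(f zero) to_unit_le0//; lra.
Qed.

Lemma homotopic_const_r f : homotopic (concat f (const_path (f one))) f.
Proof.
apply: (@homotopic_reparam _ _ (fun x => 2 * x)).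
- by move=> x; apply: cvgM; [exact: cvg_cst|exact: cvg_id].
- by apply: to_unit_le0; lra.
- by apply: to_unit_ge1; lra.
- move=> s; rewrite concatE// /concat_fun; case: ifPn => // s2.
  rewrite -[LHS]/(f one) to_unit_ge1//; move: s2; rewrite -ltNge; lra.
Qed.

Lemma homotopic_concatA f g k : f one = g zero -> g one = k zero ->
  homotopic (concat (concat f g) k) (concat f (concat g k)).
Proof.
move=> fg gk.
have fgk : concat f g one = k zero by rewrite concat1.
have fgk' : f one = concat g k zero by rewrite concat0.
pose m (x : R) := Num.min (2 * x) (Num.min (x + 1 / 4) ((x + 1) / 2)).
have m1 x : x <= 1 / 4 -> m x = 2 * x.
  by move=> x4; rewrite /m [Num.min (x + _) _]min_l ?min_l//; lra.
have m2 x : 1 / 4 <= x <= 1 / 2 -> m x = x + 1 / 4.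
  by move=> /andP[x4 x2]; rewrite /m [Num.min (x + _) _]min_l ?min_r//; lra.
have m3 x : 1 / 2 <= x <= 1 -> m x = (x + 1) / 2.
  by move=> /andP[x2 x1]; rewrite /m [Num.min (x + _) _]min_r ?min_r//; lra.
apply: (@homotopic_reparam _ _ m).
- move=> x; apply: continuous_min.
    by apply: cvgM; [exact: cvg_cst|exact: cvg_id].
  apply: continuous_min.
    by apply: cvgD; [exact: cvg_id|exact: cvg_cst].
  apply: cvgM; last exact: cvg_cst.
  by apply: cvgD; [exact: cvg_id|exact: cvg_cst].
- by rewrite m1 ?to_unit_le0//; lra.
- by rewrite m3 ?to_unit_ge1//; lra.
- move=> s; have /andP[s0 s1] := unit_val_itv s.
  rewrite (concatE fgk) (concatE fgk') /concat_fun !(concatE fg) !(concatE gk).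
  rewrite /concat_fun; case: (leP (\val s) (1 / 4)) => s4.
    have e1 : \val (to_unit (2 * \val s)) = 2 * \val s by apply: to_unit_id; lra.
    have -> : \val s <= 1 / 2 by lra.
    rewrite m1// e1; have -> : 2 * \val s <= 1 / 2 by lra.
    by [].
  case: (leP (\val s) (1 / 2)) => s2.
    have e1 : \val (to_unit (2 * \val s)) = 2 * \val s by apply: to_unit_id; lra.
    have e2 : \val (to_unit (\val s + 1 / 4)) = \val s + 1 / 4.
      by apply: to_unit_id; lra.
    have e3 : \val (to_unit (2 * (\val s + 1 / 4) - 1)) =
      2 * (\val s + 1 / 4) - 1 by apply: to_unit_id; lra.
    rewrite m2 ?(ltW s4)// e1 e2 e3.
    have -> : 2 * \val s <= 1 / 2 = false by apply/negbTE; rewrite -ltNge; lra.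
    have -> : \val s + 1 / 4 <= 1 / 2 = false by apply/negbTE; rewrite -ltNge; lra.
    have -> : 2 * (\val s + 1 / 4) - 1 <= 1 / 2 by lra.
    by congr (g (to_unit _)); lra.
  have e2 : \val (to_unit ((\val s + 1) / 2)) = (\val s + 1) / 2.
    by apply: to_unit_id; lra.
  have e3 : \val (to_unit (2 * ((\val s + 1) / 2) - 1)) =
    2 * ((\val s + 1) / 2) - 1 by apply: to_unit_id; lra.
  rewrite m3 ?(ltW s2)// e2 e3.
  have -> : (\val s + 1) / 2 <= 1 / 2 = false by apply/negbTE; rewrite -ltNge; lra.
  have -> : 2 * ((\val s + 1) / 2) - 1 <= 1 / 2 = false.
    by apply/negbTE; rewrite -ltNge; lra.
  by congr (k (to_unit _)); lra.
Qed.

Lemma Pi_basic_refl (U V : set X) f :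
  U (f zero) -> V (f one) -> Pi_basic U V f (path_class f).
Proof.
move=> Uf Vf; exists (const_path (f zero)), (const_path (f one)).
split=> //; apply/path_classP/homotopic_sym.
apply: homotopic_trans (homotopic_const_r f).
apply: homotopic_concat; [by rewrite concat1|exact: homotopic_const_l|].
exact: homotopic_refl.
Qed.

Lemma path_in_concat (U : set X) f g : f one = g zero ->
  path_in U f -> path_in U g -> path_in U (concat f g).
Proof. by move=> fg Uf Ug t; rewrite concatE// /concat_fun; case: ifP. Qed.

Lemma Pi_basic_ends (U V : set X) f g : Pi_basic U V f (path_class g) ->
  U (g zero) /\ V (g one).
Proof.
move=> [d1 [d2 [Ud1 d1f Vd2 d2f /path_classP/homotopic_ends[-> ->]]]].
have e : concat d1 f one = d2 zero by rewrite concat1.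
by rewrite concat0// concat0// concat1.
Qed.

Lemma Pi_basic_sub (U V U' V' : set X) f g : U' `<=` U -> V' `<=` V ->
  Pi_basic U V f (path_class g) -> Pi_basic U' V' g `<=` Pi_basic U V f.
Proof.
move=> UU VV [d1 [d2 [Ud1 d1f Vd2 d2f /path_classP gE]]] q [e1 [e2]].
have [g0 g1] := homotopic_ends gE.
have e : concat d1 f one = d2 zero by rewrite concat1.
move: (g0) (g1); rewrite concat0// concat0// concat1// => gz go.
move=> [Ue1 e1g Ve2 e2g ->].
have e1d : e1 one = d1 zero by rewrite e1g.
have d2e : d2 one = e2 zero by rewrite e2g.
exists (concat e1 d1), (concat d2 e2); split.
- by apply: path_in_concat => // t; exact: UU.
- by rewrite concat1.
- by apply: path_in_concat => // t; exact: VV.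
- by rewrite concat0.
have A1 : e1 one = concat (concat d1 f) d2 zero by rewrite e1g.
have A2 : concat (concat d1 f) d2 one = e2 zero by rewrite -g1.
have A3 : e1 one = concat d1 f zero by rewrite concat0.
have A4 : concat e1 (concat d1 f) one = d2 zero by rewrite concat1// concat1.
have A5 : concat e1 d1 one = f zero by rewrite concat1.
apply/path_classP.
apply: (@homotopic_trans (concat (concat e1 (concat (concat d1 f) d2)) e2)).
  apply: homotopic_concat; [by rewrite concat1| |exact: homotopic_refl].
  by apply: homotopic_concat => //; exact: homotopic_refl.
apply: (@homotopic_trans (concat (concat (concat e1 (concat d1 f)) d2) e2)).
  apply: homotopic_concat; [by rewrite concat1| |exact: homotopic_refl].
  by apply: homotopic_sym; exact: homotopic_concatA.
apply: (@homotopic_trans (concat (concat e1 (concat d1 f)) (concat d2 e2))).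
  exact: homotopic_concatA.
apply: homotopic_concat; [by rewrite concat1// concat1// concat0| |exact: homotopic_refl].
by apply: homotopic_sym; exact: homotopic_concatA.
Qed.

Lemma path_classK (p : Pi) : exists f, path_class f = p.
Proof. by exists (repr p); exact: reprK. Qed.

Lemma basis_Pi_basis : basis nice -> basis Pi_basis.
Proof.
move=> [nopen bX].
have nsub x (A : set X) : open A -> A x ->
    exists U, [/\ nice U, U x & U `<=` A].
  move=> oA Ax; have [U [nU Ux] UA] := bX x A (open_nbhs_nbhs (conj oA Ax)).
  by exists U.
have Pi_in (p : Pi) : exists S, Pi_basis S /\ S p.
  have [f <-] := path_classK p.
  have [U [nU Uf _]] := nsub (f zero) setT openT Logic.I.
  have [V [nV Vf _]] := nsub (f one) setT openT Logic.I.
  exists (Pi_basic U V f); split; last exact: Pi_basic_refl.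
  by exists U, V, f.
have Pi_join (S S' : set Pi) p : Pi_basis S -> Pi_basis S' -> S p ->
    S' p -> exists T, [/\ Pi_basis T, T p & T `<=` S `&` S'].
  have [f <-] := path_classK p.
  move=> [U [V [g [nU nV Ug Vg ->]]]] [U' [V' [g' [nU' nV' Ug' Vg' ->]]]] Sf S'f.
  have [Uf Vf] := Pi_basic_ends Sf; have [U'f V'f] := Pi_basic_ends S'f.
  have [oU oU' oV oV'] : [/\ open U, open U', open V & open V'].
    by split; exact: nopen.
  have [U2 [nU2 U2f U2s]] :=
    nsub (f zero) (U `&` U') (openI oU oU') (conj Uf U'f).
  have [V2 [nV2 V2f V2s]] :=
    nsub (f one) (V `&` V') (openI oV oV') (conj Vf V'f).
  exists (Pi_basic U2 V2 f); split; first by exists U2, V2, f.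
    exact: Pi_basic_refl.
  move=> q Sq; split.
    by apply: (Pi_basic_sub _ _ Sf) Sq => z => [/U2s|/V2s] [].
  by apply: (Pi_basic_sub _ _ S'f) Sq => z => [/U2s|/V2s] [].
split=> [S bS|p A].
  exists [set S]; last by rewrite bigcup_set1.
  move=> _ ->; exists [fset S]%fset; last by rewrite set_fset1 bigcap_set1.
  by move=> S' /fset1P ->; exact/mem_set.
rewrite nbhsE => -[W [[D' D'F <-] [C D'C Cp]] WA].
have [F FB FC] := D'F _ D'C.
suff [T [bT Tp TF]] : exists T : set Pi,
    [/\ Pi_basis T, T p & forall S, S \in enum_fset F -> T `<=` S].
  exists T => // q Tq; apply: WA; exists C => //.
  suff : C q by [].
  by rewrite -FC => S FS; exact: (TF _ FS _ Tq).
have : forall S, S \in enum_fset F -> Pi_basis S /\ S p.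
  by move=> S FS; split; [exact/set_mem/FB|move: Cp; rewrite -FC; apply].
elim: (enum_fset F) => [_|S r IHr HS].
  by have [T [bT Tp]] := Pi_in p; exists T.
have [|T [bT Tp Tr]] := IHr; first by move=> S' S'r; apply: HS; rewrite inE S'r orbT.
have [bS Sp] := HS S (mem_head _ _).
have [T' [bT' T'p T's]] := Pi_join _ _ _ bT bS Tp Sp.
exists T'; split=> // S'; rewrite inE => /predU1P[->|S'r] q /T's[Tq Sq] //.
exact: Tr Tq.
Qed.

Definition local_sections (k : nat) :=
  exists U : 'I_k.+1 -> set Pi,
    \bigcup_j U j = setT /\
    forall j, open (U j) /\
      exists2 s : Pi -> path_space, {within U j, continuous s} &
        forall p, U j p -> path_class (s p) = p.

(* The infimum of a nonempty set of natural numbers is its minimum, and that of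
   the empty set is +oo. *)
Definition asphericity_complexity : \bar R :=
  ereal_inf [set k%:R%:E | k in local_sections].

End paths.

(* Main.v *)
Require Import Defs.
From mathcomp Require Import all_boot all_order all_algebra.
From mathcomp Require Import all_classical all_reals all_analysis.
From mathcomp Require Import lra ring.

(** The main point is that every open subset W of Pi(X) is the cozero set of a
    continuous function. For a point y and an open set A of the universal
    covering based at y, a weight in [0,1] is defined by induction on the
    dimension of the cell of y, by extending functions radially from the
    boundary of a cell to its interior; it is positive iff A contains the base
    point. For a fixed A the weight is continuous on the universal covering, and
    it is upper semicontinuous uniformly in A. Hence the supremum of
    min(weight A p(0), weight B p(1)), over all A, B such that W contains
    A^-1 p B, is continuous in p, and it is positive exactly on W.

    Let now f_i and g_j be such functions for the domains of local sections which
    cover Pi(X) and Pi(Y), with n+1 and m+1 indices respectively. For nonempty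
    sets of indices S and T, the points of Pi(X x Y) where the products f_i g_j
    with (i,j) in S x T are positive and exceed all the other products form an
    open set with a local section obtained by pairing. These open sets cover
    Pi(X x Y), and two of them with the same value of |S| + |T| are disjoint;
    since |S| + |T| ranges over 2, ..., n+m+2, uniting them according to this
    value gives n+m+1 open sets with local sections. *)

Set Implicit Arguments.
Unset Strict Implicit.
Unset Printing Implicit Defensive.

Import Order.TTheory GRing.Theory Num.Theory.
Import numFieldNormedType.Exports.

Local Open Scope classical_set_scope.
Local Open Scope ring_scope.

(** * The fundamental groupoid *)

Section groupoid.
Context {R : realType} {X : topologicalType}.
Local Notation I := (unit_interval R).
Implicit Types (f g h : path_space R X) (p q r : Pi R X).

(** Follow the straight segments from [a t] to [b t] and map them by [M]; the ends stay fixed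
    because [a] and [b] agree there. Reparametrisations and the contraction of loops in a cell are
    instances. *)
Lemma convex_homotopic (E : normedModType R) (M : E -> X) (a b : I -> E) f g :
  continuous M -> continuous a -> continuous b ->
  a zero = b zero -> a one = b one ->
  (forall t, f t = M (a t)) -> (forall t, g t = M (b t)) -> homotopic f g.
Proof.
move=> cM ca cb ab0 ab1 fE gE.
have cfst (c : I -> E) : continuous c -> continuous (fun z : I * I => c z.1).
  by move=> cc z; apply: (@continuous_comp _ _ _ (@fst I I) c);
    [exact: cvg_fst|exact: cc].
exists (fun z => M ((1 - \val z.2) *: a z.1 + \val z.2 *: b z.1)).
  move=> z; apply: (@continuous_comp _ _ _
    (fun z : I * I => (1 - \val z.2) *: a z.1 + \val z.2 *: b z.1) M); last exact: cM.
  apply: cvgD; apply: cvgZ.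
  - exact: (continuous_subl (@snd_val_continuous R)).
  - exact: cfst.
  - exact: snd_val_continuous.
  - exact: cfst.
split=> [s|s|t|t].
- rewrite -[LHS]/(M ((1 - \val (zero : I)) *: a s + \val (zero : I) *: b s)).
  by rewrite unit_val0 subr0 scale1r scale0r addr0 fE.
- rewrite -[LHS]/(M ((1 - \val (one : I)) *: a s + \val (one : I) *: b s)).
  by rewrite unit_val1 subrr scale1r scale0r add0r gE.
- by rewrite fE /= -ab0 -scalerDl subrK scale1r.
- by rewrite fE /= -ab1 -scalerDl subrK scale1r.
Qed.

Lemma rev_continuous f : continuous (fun t : I => f (to_unit (1 - \val t))).
Proof.
move=> t; apply: (@continuous_comp _ _ _ (fun t : I => to_unit (1 - \val t)) f);
  last exact: path_continuous.
apply: (@continuous_comp _ _ _ (fun t : I => 1 - \val t) (@to_unit R));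
  last exact: to_unit_continuous.
exact: (continuous_subl (@unit_val_continuous R)).
Qed.

Definition rev_path f : path_space R X := mkpath (@rev_continuous f).

Lemma rev_pathE f t : rev_path f t = f (to_unit (1 - \val t)). Proof. by []. Qed.

Lemma rev_path0 f : rev_path f zero = f one.
Proof. by rewrite rev_pathE unit_val0 subr0. Qed.

Lemma rev_path1 f : rev_path f one = f zero.
Proof. by rewrite rev_pathE unit_val1 subrr. Qed.

Lemma to_unit_path_continuous f : continuous (fun x : R => f (to_unit x)).
Proof.
move=> x; apply: (@continuous_comp _ _ _ (@to_unit R) f);
  [exact: to_unit_continuous|exact: path_continuous].
Qed.

Lemma homotopic_line f g h (a b : R -> R) : continuous a -> continuous b ->
  a 0 = b 0 -> a 1 = b 1 ->
  (forall t, f t = h (to_unit (a (\val t)))) ->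
  (forall t, g t = h (to_unit (b (\val t)))) -> homotopic f g.
Proof.
move=> ca cb ab0 ab1 fE gE.
have cv (c : R -> R) : continuous c -> continuous (fun t : I => c (\val t)).
  by move=> cc t; apply: (@continuous_comp _ _ _ (\val : I -> R) c);
    [exact: unit_val_continuous|exact: cc].
apply: (@convex_homotopic R (fun x : R => h (to_unit x))
  _ _ _ _ _ (cv _ ca) (cv _ cb)) => //.
- exact: to_unit_path_continuous.
- by rewrite unit_val0.
- by rewrite unit_val1.
Qed.

Lemma homotopic_concat_rev f :
  homotopic (concat f (rev_path f)) (const_path R (f zero)).
Proof.
(* Both paths are reparametrisations of [f]: the first follows a tent that rises to 1 and returns to
   0, the second stays at 0. *)
apply: (@homotopic_line _ _ f (fun x => Num.min (2 * x) (2 - 2 * x)) (fun=> 0)).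
- move=> x; apply: continuous_min.
    by apply: cvgM; [exact: cvg_cst|exact: cvg_id].
  by apply: cvgB; [exact: cvg_cst|apply: cvgM; [exact: cvg_cst|exact: cvg_id]].
- by move=> x; exact: cvg_cst.
- by rewrite min_l; lra.
- by rewrite min_r; lra.
- move=> t; rewrite concatE ?rev_path0// /concat_fun.
  have /andP[t0 t1] := unit_val_itv t.
  case: ifPn => t2; first by rewrite min_l//; lra.
  rewrite -ltNge in t2.
  by rewrite rev_pathE to_unit_id ?min_r; [congr (f (to_unit _)); lra|lra|lra].
- by move=> t; rewrite to_unit_le0.
Qed.

Lemma homotopic_eq f g : f =1 g -> homotopic f g.
Proof.
move=> fg; apply: (@homotopic_line _ _ f id id) => //.
- by move=> x; exact: cvg_id.
- by move=> x; exact: cvg_id.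
- by move=> t; rewrite to_unitK.
- by move=> t; rewrite to_unitK fg.
Qed.

Lemma rev_pathK f : homotopic (rev_path (rev_path f)) f.
Proof.
apply: homotopic_eq => t; rewrite !rev_pathE to_unit_id.
  by rewrite subKr to_unitK.
by have := unit_val_itv t; lra.
Qed.

Lemma homotopic_rev f g : homotopic f g -> homotopic (rev_path f) (rev_path g).
Proof.
case=> H cH [H0 H1 Hz Ho].
exists (fun z => H (to_unit (1 - \val z.1), z.2)).
  apply: reparam_continuous1 => //.
  exact: (continuous_subl (@fst_val_continuous R)).
split=> [s|s|t|t].
- exact: H0.
- exact: H1.
- rewrite rev_path0 -[LHS]/(H (to_unit (1 - \val (zero : I)), t)).
  by rewrite unit_val0 subr0.
- rewrite rev_path1 -[LHS]/(H (to_unit (1 - \val (one : I)), t)).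
  by rewrite unit_val1 subrr.
Qed.

Definition src p : X := (repr p : path_space R X) zero.
Definition tgt p : X := (repr p : path_space R X) one.
(** Total: when the end points do not match, [concat] returns its first argument, so the groupoid
    laws assume that they match. *)
Definition compose p q : Pi R X := path_class (concat (repr p) (repr q)).
Definition inv p : Pi R X := path_class (rev_path (repr p)).
Definition idp (x : X) : Pi R X := path_class (const_path R x).

Lemma repr_class f : homotopic (repr (path_class f)) f.
Proof. by apply/path_classP; exact: reprK. Qed.

Lemma srcE f : src (path_class f) = f zero.
Proof. by have [] := homotopic_ends (repr_class f). Qed.

Lemma tgtE f : tgt (path_class f) = f one.
Proof. by have [] := homotopic_ends (repr_class f). Qed.

Lemma compE f g : f one = g zero ->
  compose (path_class f) (path_class g) = path_class (concat f g).
Proof.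
move=> fg; apply/path_classP; apply: homotopic_concat; try exact: repr_class.
by have := srcE g; have := tgtE f; rewrite /src /tgt => -> ->.
Qed.

Lemma invE f : inv (path_class f) = path_class (rev_path f).
Proof. by apply/path_classP/homotopic_rev/repr_class. Qed.

Lemma PiP p : exists f, p = path_class f.
Proof. by have [f <-] := path_classK p; exists f. Qed.

Lemma src_comp p q : tgt p = src q -> src (compose p q) = src p.
Proof.
have [f ->] := PiP p; have [g ->] := PiP q; rewrite tgtE srcE => fg.
by rewrite compE// !srcE concat0.
Qed.

Lemma tgt_comp p q : tgt p = src q -> tgt (compose p q) = tgt q.
Proof.
have [f ->] := PiP p; have [g ->] := PiP q; rewrite tgtE srcE => fg.
by rewrite compE// !tgtE concat1.
Qed.

Lemma src_inv p : src (inv p) = tgt p.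
Proof. by have [f ->] := PiP p; rewrite invE srcE tgtE rev_path0. Qed.

Lemma tgt_inv p : tgt (inv p) = src p.
Proof. by have [f ->] := PiP p; rewrite invE tgtE srcE rev_path1. Qed.

Lemma src_idp x : src (idp x) = x. Proof. by rewrite srcE. Qed.

Lemma tgt_idp x : tgt (idp x) = x. Proof. by rewrite tgtE. Qed.

Lemma compA p q r : tgt p = src q -> tgt q = src r ->
  compose p (compose q r) = compose (compose p q) r.
Proof.
have [f ->] := PiP p; have [g ->] := PiP q; have [h ->] := PiP r.
rewrite !tgtE !srcE => fg gh.
rewrite !compE ?concat0 ?concat1//; apply/path_classP/homotopic_sym.
exact: homotopic_concatA.
Qed.

Lemma comp1p x p : src p = x -> compose (idp x) p = p.
Proof.
have [f ->] := PiP p; rewrite srcE => <-; rewrite compE//.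
exact/path_classP/homotopic_const_l.
Qed.

Lemma compp1 x p : tgt p = x -> compose p (idp x) = p.
Proof.
have [f ->] := PiP p; rewrite tgtE => <-; rewrite compE//.
exact/path_classP/homotopic_const_r.
Qed.

Lemma invK p : inv (inv p) = p.
Proof. by have [f ->] := PiP p; rewrite !invE; apply/path_classP/rev_pathK. Qed.

Lemma comppV p : compose p (inv p) = idp (src p).
Proof.
have [f ->] := PiP p; rewrite srcE invE compE ?rev_path0//.
exact/path_classP/homotopic_concat_rev.
Qed.

Lemma compVp p : compose (inv p) p = idp (tgt p).
Proof. by rewrite -{2}[p]invK comppV src_inv. Qed.

Lemma compKV p q : tgt p = src q -> compose (inv p) (compose p q) = q.
Proof.
by move=> pq; rewrite compA ?tgt_inv ?src_inv// compVp comp1p.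
Qed.

Lemma compVK p q : src p = src q -> compose p (compose (inv p) q) = q.
Proof.
by move=> pq; rewrite compA ?tgt_inv ?src_inv// comppV comp1p.
Qed.

Definition inside (U : set X) p := exists2 f, p = path_class f & path_in U f.

Lemma inside_ends U p : inside U p -> U (src p) /\ U (tgt p).
Proof. by case=> f -> Uf; rewrite srcE tgtE. Qed.

Lemma inside_comp U p q : tgt p = src q ->
  inside U p -> inside U q -> inside U (compose p q).
Proof.
move=> /[swap] -[f -> Uf] /[swap] -[g -> Ug]; rewrite tgtE srcE => fg.
by exists (concat f g); [rewrite compE|exact: path_in_concat].
Qed.

Lemma inside_inv U p : inside U p -> inside U (inv p).
Proof. by case=> f -> Uf; exists (rev_path f); [rewrite invE|move=> t; exact: Uf]. Qed.

Lemma inside_idp (U : set X) x : U x -> inside U (idp x).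
Proof. by move=> Ux; exists (const_path R x). Qed.

Lemma inside_sub (U V : set X) p : U `<=` V -> inside U p -> inside V p.
Proof. by move=> UV [f -> Uf]; exists f => // t; exact/UV. Qed.

(** The class [compose p (inv q)] is represented by a loop in [U], which is null-homotopic in [X].
    Thus a condition on classes inside a nice set becomes a condition on their ends. *)
Lemma nice_unique U p q : nice R U -> inside U p -> inside U q ->
  src p = src q -> tgt p = tgt q -> p = q.
Proof.
move=> [_ _ Unull] Up Uq s t.
have Upq : inside U (compose p (inv q)).
  by apply: inside_comp; rewrite ?src_inv//; exact: inside_inv.
have : compose p (inv q) = idp (src p).
  case: Upq (src_comp (p := p) (q := inv q)) (tgt_comp (p := p) (q := inv q)).
  move=> f -> Uf; rewrite src_inv tgt_inv srcE tgtE => f0 f1.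
  rewrite s; apply/path_classP; apply: Unull => //; rewrite ?f0 ?f1//.
  by rewrite -s; have [] := inside_ends Up.
move=> /(congr1 (fun r => compose r q)); rewrite -compA ?src_inv ?tgt_inv//.
by rewrite compVp compp1 ?comp1p.
Qed.

Lemma nice_path U x y : nice R U -> U x -> U y ->
  exists p, [/\ inside U p, src p = x & tgt p = y].
Proof.
move=> [_ pc _] Ux Uy; have [f [Uf fx fy]] := pc x y Ux Uy.
by exists (path_class f); rewrite srcE tgtE; split=> //; exists f.
Qed.

(** Expresses the basic neighbourhoods by the groupoid operations, so that later arguments can be
    algebraic. *)
Lemma Pi_basicE U V p q : U (src p) -> V (tgt p) ->
  Pi_basic U V (repr p) q <->
  exists u v, [/\ inside U u, inside V v, tgt u = src p, src v = tgt p &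
    q = compose (compose u p) v].
Proof.
move=> Up Vp; split.
  move=> [d1 [d2 [Ud1 d1p Vd2 d2p ->]]].
  exists (path_class d1), (path_class d2); rewrite tgtE srcE; split=> //.
  - by exists d1.
  - by exists d2.
  - have e : p = path_class (repr p) by exact/esym/reprK.
    by rewrite [in RHS]e !compE// concat1// d2p.
move=> [_ [_ [[d1 -> Ud1] [d2 -> Vd2]]]]; rewrite tgtE srcE => d1p d2p ->.
exists d1, d2; split=> //.
have e : p = path_class (repr p) by exact/esym/reprK.
by rewrite [in LHS]e !compE// concat1// d2p.
Qed.

End groupoid.

(** * Path classes under a continuous map *)

Section path_image.
Context {R : realType} {X Y : topologicalType} (h : X -> Y) (ch : continuous h).
Implicit Types (f g : path_space R X) (p q : Pi R X).

Lemma map_path_continuous f : continuous (h \o f).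
Proof.
by move=> t; apply: continuous_comp; [exact: path_continuous|exact: ch].
Qed.

Definition map_path f : path_space R Y := mkpath (@map_path_continuous f).

Lemma map_pathE f t : map_path f t = h (f t). Proof. by []. Qed.

Lemma homotopic_map f g : homotopic f g -> homotopic (map_path f) (map_path g).
Proof.
case=> H cH [H0 H1 Hz Ho]; exists (h \o H).
  by move=> z; apply: continuous_comp; [exact: cH|exact: ch].
by split=> [s|s|t|t] /=; rewrite ?H0 ?H1 ?Hz ?Ho.
Qed.

Lemma map_path_concat f g : f one = g zero ->
  homotopic (concat (map_path f) (map_path g)) (map_path (concat f g)).
Proof.
move=> fg; apply: homotopic_eq => t.
rewrite concatE ?map_pathE ?fg// /concat_fun concatE// /concat_fun.
by case: ifP.
Qed.

Definition map_Pi p : Pi R Y := path_class (map_path (repr p)).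

Lemma map_PiE f : map_Pi (path_class f) = path_class (map_path f).
Proof. by apply/path_classP/homotopic_map/repr_class. Qed.

Lemma src_map p : src (map_Pi p) = h (src p).
Proof. by have [f ->] := PiP p; rewrite map_PiE !srcE. Qed.

Lemma tgt_map p : tgt (map_Pi p) = h (tgt p).
Proof. by have [f ->] := PiP p; rewrite map_PiE !tgtE. Qed.

Lemma map_comp p q : tgt p = src q ->
  map_Pi (compose p q) = compose (map_Pi p) (map_Pi q).
Proof.
have [f ->] := PiP p; have [g ->] := PiP q; rewrite tgtE srcE => fg.
rewrite compE// !map_PiE compE ?map_pathE ?fg//.
exact/esym/path_classP/map_path_concat.
Qed.

Lemma map_idp x : map_Pi (idp x) = idp (h x).
Proof. by rewrite map_PiE; apply/path_classP/homotopic_eq. Qed.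

Lemma inside_map (U : set X) (V : set Y) p : U `<=` h @^-1` V ->
  inside U p -> inside V (map_Pi p).
Proof.
by move=> UV [f -> Uf]; exists (map_path f); [rewrite map_PiE|move=> t; exact/UV].
Qed.

End path_image.

(** * Straight segments and their images *)

Section line.
Context {R : realType} {E : normedModType R}.
Local Notation I := (unit_interval R).
Implicit Types v w : E.

Lemma continuous_lincomb (T : topologicalType) (a b : T -> R) (v w : T -> E) :
  continuous a -> continuous b -> continuous v -> continuous w ->
  continuous (fun t => a t *: v t + b t *: w t).
Proof.
move=> ca cb cv cw t.
apply: (@continuousD R E T (fun t => a t *: v t) (fun t => b t *: w t)).
  by apply: continuousZ; [exact: ca|exact: cv].
by apply: continuousZ; [exact: cb|exact: cw].
Qed.

Lemma line_continuous v w :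
  continuous (fun t : I => (1 - \val t) *: v + \val t *: w).
Proof.
apply: (@continuous_lincomb I).
- exact: (continuous_subl (@unit_val_continuous R)).
- exact: unit_val_continuous.
- exact: cst_continuous.
- exact: cst_continuous.
Qed.

Definition line v w : path_space R E := mkpath (@line_continuous v w).

Lemma lineE v w t : line v w t = (1 - \val t) *: v + \val t *: w.
Proof. by []. Qed.

Lemma line0 v w : line v w zero = v.
Proof. by rewrite lineE unit_val0 subr0 scale1r scale0r addr0. Qed.

Lemma line1 v w : line v w one = w.
Proof. by rewrite lineE unit_val1 subrr scale1r scale0r add0r. Qed.

Lemma normed_homotopic (f g : path_space R E) :
  f zero = g zero -> f one = g one -> homotopic f g.
Proof.
move=> fg0 fg1; apply: (@convex_homotopic _ _ E id f g) => //.
- by move=> x; exact: cvg_id.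
- exact: path_continuous.
- exact: path_continuous.
Qed.

Lemma normed_Pi_eq (p q : Pi R E) : src p = src q -> tgt p = tgt q -> p = q.
Proof.
have [f ->] := PiP p; have [g ->] := PiP q; rewrite !srcE !tgtE => fg0 fg1.
exact/path_classP/normed_homotopic.
Qed.

Lemma line_ball v w w' (e : R) : ball v e w -> ball v e w' ->
  path_in (ball v e) (line w w').
Proof.
rewrite -!ball_normE /= => vw vw' t; have /andP[t0 t1] := unit_val_itv t.
rewrite lineE /ball_ /mkset.
have -> : v - ((1 - \val t) *: w + \val t *: w') =
    (1 - \val t) *: (v - w) + \val t *: (v - w').
  by rewrite !scalerBr addrACA -scalerDl subrK scale1r opprD.
apply: le_lt_trans (ler_normD _ _) _; rewrite !normrZ.
rewrite ger0_norm ?subr_ge0// ger0_norm//.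
have [->|t_neq0] := eqVneq (\val t) 0; first by rewrite subr0 mul1r mul0r addr0.
have t_gt0 : 0 < \val t by rewrite lt_def t_neq0.
have -> : e = (1 - \val t) * e + \val t * e by rewrite mulrBl mul1r subrK.
by apply: ler_ltD; [rewrite ler_wpM2l ?subr_ge0// ltW|rewrite ltr_pM2l].
Qed.

End line.

Section segments.
Context {R : realType} {X : topologicalType} {E : normedModType R}.
Variables (c : E -> X) (cc : continuous c).
Implicit Types (u v w : E).

Definition seg v w : Pi R X := map_Pi cc (path_class (line v w)).

Lemma src_seg v w : src (seg v w) = c v.
Proof. by rewrite src_map srcE line0. Qed.

Lemma tgt_seg v w : tgt (seg v w) = c w.
Proof. by rewrite tgt_map tgtE line1. Qed.

(** Path classes in a normed space are determined by their ends; the composition rules for segments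
    come from this. *)
Lemma map_seg v w p : src p = v -> tgt p = w -> map_Pi cc p = seg v w.
Proof.
move=> pv pw; congr map_Pi; apply: normed_Pi_eq; first by rewrite srcE line0.
by rewrite tgtE line1.
Qed.

Lemma seg_comp u v w : compose (seg u v) (seg v w) = seg u w.
Proof.
have e : tgt (path_class (line u v)) = src (path_class (line v w)).
  by rewrite tgtE srcE line1 line0.
rewrite -map_comp//; apply: map_seg.
  by rewrite src_comp// srcE line0.
by rewrite tgt_comp// tgtE line1.
Qed.

Lemma segxx v : seg v v = idp (c v).
Proof. by rewrite -(map_idp cc); apply/esym/map_seg; rewrite ?src_idp ?tgt_idp. Qed.

Lemma inv_seg v w : inv (seg v w) = seg w v.
Proof.
rewrite -[RHS](@compKV _ _ (seg v w)) ?tgt_seg ?src_seg//.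
by rewrite seg_comp segxx compp1// tgt_inv src_seg.
Qed.

Lemma inside_seg (V : set X) (B : set E) v w : path_in B (line v w) ->
  B `<=` c @^-1` V -> inside V (seg v w).
Proof. by move=> Bvw BV; apply: inside_map BV _; exists (line v w). Qed.

Lemma seg_near (V : set X) v : open V -> V (c v) ->
  exists2 e : R, 0 < e & forall u w, ball v e u -> ball v e w -> inside V (seg u w).
Proof.
move=> oV Vv; have /nbhs_ballP[e /= e0 eV] : nbhs v (c @^-1` V).
  by apply: cc; apply: open_nbhs_nbhs.
by exists e => // u w vu vw; apply: inside_seg eV; exact: line_ball.
Qed.

End segments.

(** * Cells *)

Section euclidean.
Context {R : realType} {n : nat}.
Implicit Types (w : 'rV[R]_n) (c : R).

Definition enorm w : R := Num.sqrt (\sum_(i < n) w ord0 i ^+ 2).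

Let sq_ge0 w : 0 <= \sum_(i < n) w ord0 i ^+ 2.
Proof. by apply: sumr_ge0 => i _; exact: sqr_ge0. Qed.

Lemma enorm_ge0 w : 0 <= enorm w. Proof. exact: sqrtr_ge0. Qed.

Lemma enormZ c w : enorm (c *: w) = `|c| * enorm w.
Proof.
rewrite /enorm -sqrtr_sqr -sqrtrM ?sqr_ge0//; congr Num.sqrt.
by rewrite mulr_sumr; apply: eq_bigr => i _; rewrite mxE exprMn.
Qed.

Lemma discE w : disc w <-> enorm w <= 1.
Proof.
suff -> : (enorm w <= 1) = (\sum_(i < n) w ord0 i ^+ 2 <= 1) by [].
by rewrite /enorm -[X in Num.sqrt _ <= X]sqrtr1 ler_sqrt.
Qed.

Lemma open_discE w : open_disc w <-> enorm w < 1.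
Proof.
suff -> : (enorm w < 1) = (\sum_(i < n) w ord0 i ^+ 2 < 1) by [].
by rewrite /enorm -[X in Num.sqrt _ < X]sqrtr1 ltr_sqrt.
Qed.

Lemma sphereE w : sphere w <-> enorm w = 1.
Proof.
rewrite /sphere /=; split => [|/(congr1 (fun x => x ^+ 2))].
  by rewrite /enorm => ->; rewrite sqrtr1.
by rewrite sqr_sqrtr// expr1n.
Qed.

Lemma open_disc_disc w : open_disc w -> disc w.
Proof. by move=> /open_discE/ltW/discE. Qed.

Lemma sphere_disc w : sphere w -> disc w.
Proof. by move=> /sphereE w1; apply/discE; rewrite w1. Qed.

Lemma disc_cases w : disc w -> open_disc w \/ sphere w.
Proof.
move=> /discE; rewrite le_eqVlt => /orP[/eqP w1|w1].
  by right; apply/sphereE.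
by left; apply/open_discE.
Qed.

Lemma enorm0 : enorm 0 = 0.
Proof. by rewrite -[X in enorm X](scale0r 0) enormZ normr0 mul0r. Qed.

Lemma norm_le_enorm w : `|w| <= enorm w.
Proof.
rewrite [leLHS]mx_normrE; apply/bigmax_leP; split; first exact: enorm_ge0.
move=> [i j] _ /=; rewrite ord1 -sqrtr_sqr ler_sqrt//.
by rewrite (bigD1 j)//= lerDl sumr_ge0// => k _; exact: sqr_ge0.
Qed.

Lemma enorm_eq0 w : enorm w = 0 -> w = 0.
Proof.
by move=> w0; apply/eqP; rewrite -normr_le0 -w0; exact: norm_le_enorm.
Qed.

Lemma enorm_gt0 w : w != 0 -> 0 < enorm w.
Proof.
by move=> w0; rewrite lt_def enorm_ge0 andbT; apply: contra_neq w0 => /enorm_eq0.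
Qed.

Lemma enorm_continuous : continuous enorm.
Proof.
have csq : continuous (fun w : 'rV[R]_n => \sum_(i < n) w ord0 i ^+ 2).
  apply: continuous_big; first exact: add_continuous.
  move=> i _ v; apply: (@cvgM R _ (nbhs v) _ (fun w => w ord0 i)).
    exact: coord_continuous.
  exact: coord_continuous.
by move=> w; apply: continuous_comp; [exact: csq|exact: sqrt_continuous].
Qed.

Lemma closed_disc : closed (@disc R n).
Proof.
rewrite (_ : @disc R n = enorm @^-1` [set x | x <= 1]); last first.
  by apply/seteqP; split=> w /discE.
by apply: preimage_closed; [move=> w _; exact: enorm_continuous|exact: closed_le].
Qed.

Lemma compact_disc : compact (@disc R n).
Proof.
apply: bounded_closed_compact closed_disc.
exists 1; split; first exact: num_real.
move=> x x1 w /discE w1.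
exact: le_trans (norm_le_enorm w) (le_trans w1 (ltW x1)).
Qed.

Lemma open_open_disc : open (@open_disc R n).
Proof.
rewrite (_ : @open_disc R n = enorm @^-1` [set x | x < 1]); last first.
  by apply/seteqP; split=> w /open_discE.
by apply: open_comp => [w _|]; [exact: enorm_continuous|exact: open_lt].
Qed.

Definition retract_disc w : 'rV[R]_n := (Num.max 1 (enorm w))^-1 *: w.

Let max_gt0 w : 0 < Num.max 1 (enorm w).
Proof. by rewrite lt_max ltr01. Qed.

Lemma retract_discP w : disc (retract_disc w).
Proof.
apply/discE; rewrite enormZ gtr0_norm ?invr_gt0// mulrC ler_pdivrMr// mul1r.
by rewrite le_max lexx orbT.
Qed.

Lemma retract_disc_id w : disc w -> retract_disc w = w.
Proof. by move=> /discE w1; rewrite /retract_disc max_l// invr1 scale1r. Qed.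

Lemma retract_disc_continuous : continuous retract_disc.
Proof.
move=> w; apply: (@continuousZ R _ _ (fun w => (Num.max 1 (enorm w))^-1) id w);
  last exact: cvg_id.
apply: (@continuousV R _ (fun w => Num.max 1 (enorm w))); first exact: lt0r_neq0.
apply: (@continuous_max R _ (fun=> 1) enorm); first exact: cst_continuous.
exact: enorm_continuous.
Qed.

Lemma retract_disc_out c w : 0 < c -> 1 <= c * enorm w ->
  retract_disc (c *: w) = (enorm w)^-1 *: w.
Proof.
move=> c0 cw; rewrite /retract_disc enormZ gtr0_norm// max_r// scalerA.
by rewrite invfM mulrAC mulVf ?lt0r_neq0// mul1r.
Qed.

Definition dir w : 'rV[R]_n := (enorm w)^-1 *: w.

Lemma dir_sphere w : w != 0 -> sphere (dir w).
Proof.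
move=> w0; apply/sphereE; rewrite enormZ gtr0_norm ?invr_gt0 ?enorm_gt0//.
by rewrite mulVf// lt0r_neq0// enorm_gt0.
Qed.

Lemma dir_id w : sphere w -> dir w = w.
Proof. by move=> /sphereE w1; rewrite /dir w1 invr1 scale1r. Qed.

Lemma dirK w : w != 0 -> enorm w *: dir w = w.
Proof.
by move=> w0; rewrite scalerA mulfV ?scale1r// lt0r_neq0// enorm_gt0.
Qed.

Lemma dirZ c w : 0 < c -> dir (c *: w) = dir w.
Proof.
move=> c0; rewrite /dir enormZ gtr0_norm// scalerA; congr (_ *: _).
by rewrite invfM mulrAC mulVf ?lt0r_neq0// mul1r.
Qed.

Lemma sphere_neq0 w : sphere w -> w != 0.
Proof.
by move=> /sphereE w1; apply: contra_eq_neq w1 => ->; rewrite enorm0 eq_sym oner_eq0.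
Qed.

Lemma dir_continuous w : w != 0 -> {for w, continuous dir}.
Proof.
move=> w0; apply: (@continuousZ R _ _ (fun w => (enorm w)^-1) id w);
  last exact: cvg_id.
by apply: (@continuousV R _ enorm);
  [rewrite lt0r_neq0// enorm_gt0|exact: enorm_continuous].
Qed.

Lemma norm_sphere w : sphere w -> `|w| <= 1.
Proof. by move=> /sphereE <-; exact: norm_le_enorm. Qed.

End euclidean.

(** * Coordinates and the weak topology *)

Section cw_topology.
Context {R : realType} {X : topologicalType} (K : cw_complex R X).
Local Notation I := (unit_interval R).
Local Notation dsc a := (@disc R (cw_dim a)).
Implicit Types (a b : cw_cell K) (x y : X).

(* Precomposing with the retraction onto the disc makes the characteristic map
   continuous on the whole vector space. *)
Definition chi a (w : 'rV[R]_(cw_dim a)) : X := cw_map (retract_disc w).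
Arguments chi : clear implicits.

Lemma chiE a w : disc w -> chi a w = cw_map w.
Proof. by move=> dw; rewrite /chi retract_disc_id. Qed.

Lemma chi_retract a w : chi a (retract_disc w) = chi a w.
Proof. by rewrite chiE//; exact: retract_discP. Qed.

Lemma chi_continuous a : continuous (chi a).
Proof.
move=> w U /= Uw; have := @cw_map_continuous R X K a.
move=> /subspace_continuousP/(_ _ (retract_discP w) _ Uw) /retract_disc_continuous nb.
have {}nb : \forall v \near w,
  disc (retract_disc v) -> U (cw_map (retract_disc v)) := nb.
by apply: filterS nb => v; apply; exact: retract_discP.
Qed.

Lemma open_cellE a x : open_cell a x <-> exists2 w, open_disc w & chi a w = x.
Proof.
split=> -[w dw] <-; exists w => //; rewrite chiE//; exact: open_disc_disc.
Qed.

Lemma pcoord_subproof x : exists s : {a : cw_cell K & 'rV[R]_(cw_dim a)},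
  open_disc (projT2 s) /\ chi _ (projT2 s) = x.
Proof.
have [a /open_cellE[w dw wx]] := cw_cover K x.
by exists (existT _ a w).
Qed.

(** The cell and the disc coordinates form a dependent pair, since the dimension of the disc varies
    with the point. *)
Definition pcoord x := projT1 (cid (pcoord_subproof x)).

Definition cell_at x : cw_cell K := projT1 (pcoord x).

Lemma pcoordP x : open_disc (projT2 (pcoord x)) /\ chi _ (projT2 (pcoord x)) = x.
Proof. exact: projT2 (cid (pcoord_subproof x)). Qed.

Lemma pcoordE a w : open_disc w -> pcoord (chi a w) = existT _ a w.
Proof.
move=> dw; have [] := pcoordP (chi a w).
case: (pcoord (chi a w)) => b v /= dv vw.
have ba : b = a.
  by apply: (@cw_disjoint _ _ K _ _ (chi a w)); apply/open_cellE; [exists v|exists w].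
subst b; congr existT.
apply: (@cw_map_inj _ _ K a); rewrite ?inE//.
by rewrite -!chiE//; exact: open_disc_disc.
Qed.

Lemma cell_atE a w : open_disc w -> cell_at (chi a w) = a.
Proof. by move=> dw; rewrite /cell_at pcoordE. Qed.

Lemma open_cell_at a x : open_cell a x -> cell_at x = a.
Proof. by move=> /open_cellE[w dw <-]; exact: cell_atE. Qed.

Lemma sphere_finite a : exists F : set (cw_cell K),
  [/\ finite_set F, forall b, F b -> (cw_dim b < cw_dim a)%N &
     forall w, sphere w -> F (cell_at (chi a w))].
Proof.
have [F [fF Fa FS]] := cw_closure_finite a; exists F; split=> // w Sw.
have : (@cw_map _ _ _ a @` @sphere R _) (chi a w).
  by exists w => //; rewrite chiE//; exact: sphere_disc.
by move=> /FS[b Fb /open_cell_at ->].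
Qed.

Lemma dim_chi_sphere a w : sphere w -> (cw_dim (cell_at (chi a w)) < cw_dim a)%N.
Proof. by move=> Sw; have [F [_ + FS]] := sphere_finite a; apply; exact: FS. Qed.

Lemma disc_finite a : exists2 F : set (cw_cell K),
  finite_set F & forall w, disc w -> F (cell_at (chi a w)).
Proof.
have [F [fF _ FS]] := sphere_finite a; exists (F `|` [set a]).
  by rewrite finite_setU; split.
by move=> w /disc_cases[/cell_atE ->|/FS]; [right|left].
Qed.

(** The part of the disc in question is compact, so its image is compact, hence closed in the
    Hausdorff space [X]. *)
Lemma closed_chi a (C : set X) : closed [set w | disc w /\ C (chi a w)] ->
  closed (C `&` chi a @` dsc a).
Proof.
move=> cC; apply: compact_closed; first exact: cw_hausdorff K.
rewrite (_ : _ `&` _ = chi a @` [set w | disc w /\ C (chi a w)]).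
  apply: continuous_compact; first exact/continuous_subspaceT/chi_continuous.
  by apply: subclosed_compact cC compact_disc _ => w [].
apply/seteqP; split=> [x [Cx [w dw wx]]|_ [w [dw Cw] <-]].
  by exists w => //; split; rewrite ?wx.
by split=> //; exists w.
Qed.

Lemma closed_cell_sub a : closed_cell a `<=` chi a @` dsc a.
Proof.
have : closed (setT `&` chi a @` dsc a).
  apply: closed_chi; rewrite (_ : mkset _ = dsc a); first exact: closed_disc.
  by apply/seteqP; split=> w // [].
rewrite setTI => /closure_id ->; apply: closure_subset => _ [w dw <-].
by exists w; [exact: open_disc_disc|rewrite chiE//; exact: open_disc_disc].
Qed.

(** Relative openness on one closed disc. Working cell by cell permits an induction on the dimension
    before [weak_open] is applied. *)
Definition open_along a (O : set X) :=
  forall w, disc w -> O (chi a w) -> \forall w' \near w, disc w' -> O (chi a w').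

Lemma closed_open_along a O : open_along a O ->
  closed [set w | disc w /\ ~ O (chi a w)].
Proof.
move=> aO; rewrite -[X in closed X]setCK; apply: open_closedC; rewrite openE => w /= nw.
have [dw|ndw] := pselect (disc w).
  have Ow : O (chi a w) by apply: contrapT => nO; exact: nw.
  by have := aO _ dw Ow; apply: filterS => v vO [/vO].
have : nbhs w (~` (dsc a)).
  by apply: open_nbhs_nbhs; split => //; exact/closed_openC/closed_disc.
by apply: filterS => v ndv [].
Qed.

Lemma weak_open O : (forall a, open_along a O) -> open O.
Proof.
move=> aO; rewrite -(setCK O); apply: closed_openC.
apply: (@cw_weak_topology _ _ K) => a.
have -> : ~` O `&` closed_cell a = (~` O `&` chi a @` dsc a) `&` closed_cell a.
  by rewrite -setIA; congr (_ `&` _); apply/esym/setIidPr/closed_cell_sub.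
by apply: closedI; [exact/closed_chi/closed_open_along|exact: closed_closure].
Qed.

(** The set [O] need not be open in [X]. The boundary of [a] meets finitely many open cells, all of
    smaller dimension, and the complement of [O] is closed in the image of each of their discs. The
    union of these finitely many sets is closed and misses [chi a w]. *)
Lemma sphere_near a O w : (forall b, (cw_dim b < cw_dim a)%N -> open_along b O) ->
  sphere w -> O (chi a w) -> \forall w' \near w, sphere w' -> O (chi a w').
Proof.
move=> aO Sw Ow; have [F [fF Fa FS]] := sphere_finite a.
have cC : closed (\bigcup_(b in (F : set {classic cw_cell K}))
    (~` O `&` chi b @` dsc b)).
  by apply: closed_bigcup => // b Fb; apply/closed_chi/closed_open_along/aO/Fa.
have : nbhs w (chi a @^-1` (~` (\bigcup_(b in F) (~` O `&` chi b @` dsc b)))).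
  apply: chi_continuous; apply: open_nbhs_nbhs; split; first exact: closed_openC.
  by case=> b _ [].
apply: filterS => v nv Sv; apply: contrapT => nO; apply: nv.
exists (cell_at (chi a v)); first exact: FS.
split => //; have [dp pE] := pcoordP (chi a v).
by exists (projT2 (pcoord (chi a v))) => //; exact: open_disc_disc.
Qed.

End cw_topology.
Arguments chi {R X K} a w.
Arguments pcoord {R X} K x.
Arguments cell_at {R X} K x.

(** * Weights *)

Section depth.
Context {R : realType} {E : normedModType R}.
Implicit Types (A : set E) (v w : E) (e : R).

Let radii A w := [set e | 0 <= e <= 1 / 2 /\ ball w e `<=` A].

(* The distance from [w] to the complement of [A], cut off at 1/2. *)
Definition depth A w : R := sup (radii A w).

Let radii0 A w : radii A w 0.
Proof.
split; first by lra.
by move=> v; rewrite -ball_normE /= => /(le_lt_trans (normr_ge0 _)); rewrite ltxx.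
Qed.

Let radii_has_sup A w : has_sup (radii A w).
Proof. by split; [exists 0|exists (1 / 2) => e [/andP[]]]. Qed.

Lemma depth_ge0 A w : 0 <= depth A w.
Proof. by apply: ub_le_sup => //; have [] := radii_has_sup A w. Qed.

Lemma depth_le A w : depth A w <= 1 / 2.
Proof. by apply: ge_sup; [exists 0|move=> e [/andP[]]]. Qed.

Lemma depth_gt0 A w : 0 < depth A w <-> nbhs w A.
Proof.
split.
  move=> d0; have [|e [_ eA] e0] := @sup_gt _ (radii A w) 0 _ d0; first by exists 0.
  by apply/nbhs_ballP; exists e.
move=> /nbhs_ballP[e /= e0 eA].
apply: (@lt_le_trans _ _ (Num.min e (1 / 2))).
  by rewrite lt_min e0 /=; lra.
apply: ub_le_sup; first by have [] := radii_has_sup A w.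
split; first by rewrite le_min ge_min lexx orbT (ltW e0) /=; lra.
by move=> v wv; apply/eA/(le_ball _ wv); rewrite ge_min lexx.
Qed.

(** The constant is the same for all sets [A]; the uniformity of the later estimates starts here. *)
Lemma depth_lipschitz A v w : depth A v <= depth A w + `|v - w|.
Proof.
apply: ge_sup; first by exists 0.
move=> e [/andP[e0 e1] eA].
have [ev|ve] := leP e `|v - w|.
  by apply: le_trans ev _; rewrite lerDr depth_ge0.
rewrite -lerBlDr; apply: ub_le_sup; first by have [] := radii_has_sup A w.
split; first by have := normr_ge0 (v - w); lra.
move=> u; rewrite -ball_normE /= => wu; apply: eA; rewrite -ball_normE /=.
by apply: le_lt_trans (ler_distD w _ _) _; rewrite addrC -ltrBrDr.
Qed.

End depth.

(** * Radial extension from a sphere to its disc *)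

Section extension.
Context {R : realType}.
Implicit Types d r g e : R.

(* The value at a point of norm [r] and depth [d] of a disc, for a function
   which takes the value [g] at the radial projection of the point. *)
Definition extension d r g : R :=
  if 0 < d then Num.max (Num.min (1 - r) d) (g - (1 - r) / d) else 0.

Lemma extension_ge0 d r g : r <= 1 -> 0 <= extension d r g.
Proof.
move=> r1; rewrite /extension; case: ifPn => // d0.
by rewrite le_max le_min subr_ge0 r1 ltW.
Qed.

Lemma extension_le1 d r g : 0 <= r <= 1 -> g <= 1 -> extension d r g <= 1.
Proof.
move=> /andP[r0 r1] g1; rewrite /extension; case: ifPn => [d0|_]; last exact: ler01.
rewrite ge_max ge_min; apply/andP; split; first by apply/orP; left; lra.
have : 0 <= (1 - r) / d by rewrite divr_ge0 ?subr_ge0// ltW.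
lra.
Qed.

Lemma extension_gt0 d r g : r < 1 -> 0 <= d -> (0 < extension d r g) = (0 < d).
Proof.
move=> r1 d0; rewrite /extension; case: ifPn => d1; last by rewrite ltxx.
by rewrite lt_max lt_min subr_gt0 r1 d1.
Qed.

Lemma extension1 d g : 0 <= g -> (0 < g -> 0 < d) -> extension d 1 g = g.
Proof.
move=> g0 gd; rewrite /extension subrr mul0r subr0; case: ifPn => d0.
  by rewrite min_l ?(ltW d0)// max_r.
by apply/le_anti; rewrite g0 /= leNgt; apply: contra d0.
Qed.

(** Here [h] depends on [r0] and [e] only, which makes the estimate uniform in the set whose depth
    is [d0]. The bound [d <= 1 / 2] makes [(1 - r) / d] at least 1 when [r <= 1 / 2], so the value
    [g] matters only away from the centre, where radial projection is continuous. *)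
Lemma extension_usc r0 e : 0 <= r0 <= 1 -> 0 < e -> exists2 h, 0 < h &
  forall d0 d r g0 g, 0 <= d0 -> d <= 1 / 2 -> r <= 1 ->
    0 <= g0 -> g <= 1 -> (0 < g0 -> r0 = 1 -> 0 < d0) ->
    `|r - r0| < h -> d <= d0 + h -> (1 / 2 < r -> g <= g0 + e / 2) ->
    extension d r g <= extension d0 r0 g0 + e.
Proof.
move=> /andP[r00 r01] e0.
(* On the sphere the extension is [g0] itself; [h <= e] bounds [1 - r] by [e], and [h <= 1 / 2]
   forces [1 / 2 < r]. *)
have [r1|r1] := eqVneq r0 1.
  exists (Num.min e (1 / 2)); first by rewrite lt_min e0 /=; lra.
  move=> d0 d r g0 g dge0 d2 rle1 g00 g1 gd.
  rewrite lt_min => /andP[rr0 rr1] _ gg0.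
  rewrite r1 extension1//; last by move=> ?; exact: gd.
  rewrite /extension; case: ifPn => dpos; last by lra.
  rewrite r1 in rr0 rr1; move: rr0; rewrite ltr_distl => /andP[rr0 _].
  move: rr1; rewrite ltr_distl => /andP[rr1 _].
  rewrite ge_max ge_min; apply/andP; split; first by apply/orP; left; lra.
  have q0 : 0 <= (1 - r) / d by rewrite divr_ge0 ?subr_ge0// ltW.
  by have := gg0 ltac:(lra); lra.
have s0 : 0 < 1 - r0 by rewrite subr_gt0 lt_def eq_sym r1.
set s := 1 - r0 in s0 *.
pose h := Num.min (Num.min (s / 4) e) (e * s ^+ 2 / 16).
have h0 : 0 < h.
  rewrite !lt_min e0 divr_gt0//=; apply: divr_gt0 => //.
  by rewrite mulr_gt0// exprn_gt0.
have [hs he hes] : [/\ h <= s / 4, h <= e & h <= e * s ^+ 2 / 16].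
  by split; rewrite !ge_min lexx ?orbT.
exists h => // d0 d r g0 g dge0 d2 rle1 g00 g1 _.
rewrite ltr_distl => /andP[rr0 rr1] dd0 gg0.
have ext0 : 0 <= extension d0 r0 g0 by exact: extension_ge0.
rewrite {1}/extension; case: ifPn => dpos; last by lra.
rewrite ge_max; apply/andP; split.
  have [d0pos|d0neg] := ltP 0 d0; last by rewrite ge_min; apply/orP; right; lra.
  have : Num.min (1 - r0) d0 <= extension d0 r0 g0.
    by rewrite /extension d0pos le_max lexx.
  case: (leP (1 - r0) d0) => _ d0E; rewrite ge_min; apply/orP; [left|right]; lra.
(* If the second term is too large it is positive, so [1 - r < d], and [d0] is then at least
   [s / 2]. With this lower bound the quotients [(1 - r) / d] and [s / d0] can be compared. *)
have [//|Tpos] := leP (g - (1 - r) / d) (extension d0 r0 g0 + e).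
have rd : 1 - r < d.
  by rewrite -[X in _ < X]mul1r -ltr_pdivrMr//; lra.
have d0s : s / 2 <= d0 by rewrite /s in hs *; lra.
have d0pos : 0 < d0 by apply: lt_le_trans d0s; exact: divr_gt0.
have gle := gg0 ltac:(lra).
have : g0 - s / d0 <= extension d0 r0 g0.
  by rewrite /extension d0pos le_max lexx orbT.
suff : s / d0 - e / 2 <= (1 - r) / d by lra.
rewrite ler_pdivlMr//.
set k := s / d0.
have kE : k * d0 = s by rewrite /k divfK// lt0r_neq0.
have k0 : 0 <= k by rewrite divr_ge0// ltW.
have k2 : k <= 2 by rewrite /k ler_pdivrMr//; lra.
have h3 : 3 * h <= e * d0 / 2.
  have es : e * s ^+ 2 <= e * s.
    have s1 : s <= 1 by rewrite /s; lra.
    by rewrite expr2 ler_wpM2l ?(ltW e0)// ler_piMr// ltW.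
  have : e * s <= e * (2 * d0) by rewrite ler_wpM2l ?(ltW e0)//; lra.
  lra.
apply: (@le_trans _ _ ((1 - r0) - h)); last by lra.
rewrite -/s.
have [ke|ke] := leP 0 (k - e / 2); last first.
  apply: (@le_trans _ _ 0); last by lra.
  by rewrite mulr_le0_ge0// ltW.
apply: (@le_trans _ _ ((k - e / 2) * (d0 + h))); first by rewrite ler_wpM2l.
have kh : k * h <= 2 * h by rewrite ler_wpM2r// ltW.
have eh : 0 <= e * h by rewrite mulr_ge0// ltW.
rewrite mulrBl !mulrDr kE; lra.
Qed.

(** In contrast to the upper estimate, [h] depends on [d0], as the quotient is steep for small [d0].
    Hence lower semicontinuity is obtained for one set at a time. *)
Lemma extension_lsc d0 r0 e : 0 <= d0 <= 1 / 2 -> 0 <= r0 <= 1 -> 0 < e ->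
  exists2 h, 0 < h & forall d r g0 g, r <= 1 -> g0 <= 1 ->
    `|r - r0| < h -> `|d - d0| < h -> (0 < r0 -> g0 - e / 2 <= g) ->
    extension d0 r0 g0 - e <= extension d r g.
Proof.
move=> /andP[d00 d02] /andP[r00 r01] e0.
have [d0pos|d0neg] := ltP 0 d0; last first.
  exists 1 => // d r g0 g r1 _ _ _ _.
  rewrite {1}/extension ifF; last by apply/negbTE; rewrite -leNgt.
  by have := extension_ge0 d g r1; lra.
pose h := Num.min (Num.min (d0 / 2) e) (e * d0 ^+ 2 / 8).
have h0 : 0 < h.
  rewrite !lt_min e0 divr_gt0//=; apply: divr_gt0 => //.
  by rewrite mulr_gt0// exprn_gt0.
have [hs he hes] : [/\ h <= d0 / 2, h <= e & h <= e * d0 ^+ 2 / 8].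
  by split; rewrite !ge_min lexx ?orbT.
exists h => // d r g0 g r1 g01.
rewrite !ltr_distl => /andP[rr0 rr1] /andP[dd0 dd1] gg.
have dpos : 0 < d by lra.
have ext0 := extension_ge0 d g r1.
rewrite {1}/extension d0pos lerBlDr ge_max; apply/andP; split.
  have : Num.min (1 - r) d <= extension d r g.
    by rewrite /extension dpos le_max lexx.
  case: (leP (1 - r) d) => _ dE; rewrite ge_min; apply/orP; [left|right]; lra.
have [//|Tpos] := leP (g0 - (1 - r0) / d0) (extension d r g + e).
(* At the centre the second term is at most 0, as [g0 <= 1] and [d0 <= 1 / 2], so it cannot be the
   large one. *)
have r0pos : 0 < r0.
  rewrite lt_def r00 andbT; apply/eqP => r0E; move: Tpos; rewrite r0E subr0 div1r.
  have : 1 <= d0^-1 by rewrite invf_ge1//; lra.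
  lra.
have := gg r0pos => gle.
have : g - (1 - r) / d <= extension d r g.
  by rewrite /extension dpos le_max lexx orbT.
suff : (1 - r) / d <= (1 - r0) / d0 + e / 2 by lra.
rewrite ler_pdivrMr//.
set k := (1 - r0) / d0.
have kE : k * d0 = 1 - r0 by rewrite /k divfK// lt0r_neq0.
have k0 : 0 <= k by rewrite divr_ge0 ?subr_ge0.
have kd : k <= d0^-1 by rewrite /k ler_pdivrMr// mulVf ?lt0r_neq0//; lra.
have hd : h * d0^-1 <= e * d0 / 8.
  rewrite -ler_pdivlMr ?invr_gt0// invrK.
  by apply: le_trans hes _; rewrite expr2; lra.
have kh : k * h <= e * d0 / 8 by apply: le_trans hd; rewrite mulrC ler_wpM2l// ltW.
have he8 : h <= e * d0 / 16.
  apply: le_trans hes _; rewrite expr2.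
  have : e * (d0 * d0) <= e * (d0 / 2).
    by rewrite ler_wpM2l ?(ltW e0)//; nra.
  lra.
apply: (@le_trans _ _ ((k + e / 2) * (d0 - h))); last first.
  by rewrite ler_wpM2l//; lra.
have eh : e * h <= e * (d0 / 2) by rewrite ler_wpM2l// ltW.
rewrite mulrDl !mulrBr kE; lra.
Qed.

End extension.

Section weight.
Context {R : realType} {X : topologicalType} (K : cw_complex R X).
Implicit Types (A : set (Pi R X)) (p q : Pi R X) (x y : X) (a b : cw_cell K).

Local Notation sg a := (seg (@chi_continuous _ _ K a)).

(** The set [A] as seen from [tgt p], after the base point has been moved along [p]. *)
Definition translate p A : set (Pi R X) :=
  [set q | src q = tgt p /\ A (compose p q)].

(* Openness in the topology of the universal coverings, in which a path class
   moves only by its terminal point. *)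
Definition end_open A := forall p, A p -> exists V : set X,
  [/\ open V, V (tgt p) & forall q, inside V q -> src q = tgt p -> A (compose p q)].

Lemma translateA p q A : tgt p = src q ->
  translate q (translate p A) = translate (compose p q) A.
Proof.
move=> pq; apply/seteqP; split=> [r [rq [qrp]]|r [rq]].
  by rewrite compA// => Ar; split; rewrite ?tgt_comp.
rewrite tgt_comp// in rq; rewrite -compA// => Ar.
by split=> //; split; rewrite ?src_comp.
Qed.

Lemma end_open_translate p A : end_open A -> end_open (translate p A).
Proof.
move=> oA q [qp Apq]; have [V [oV Vq VA]] := oA _ Apq.
rewrite tgt_comp// in Vq VA; exists V; split=> // r Vr rq.
by split; [rewrite src_comp|rewrite compA//; exact: VA].
Qed.

(** The preimage of [A] under the lift of [chi a] to the universal covering that sends [w] to the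
    trivial class. *)
Definition reach A a (w : 'rV[R]_(cw_dim a)) : set 'rV[R]_(cw_dim a) :=
  [set w' | A (sg a w w')].

Lemma reach_translate A a w0 w : reach (translate (sg a w0 w) A) w = reach A w0.
Proof.
apply/seteqP; split=> v; rewrite /reach /translate /= seg_comp; first by case.
by rewrite src_seg tgt_seg.
Qed.

Lemma open_reach A a w : end_open A -> open (@reach A a w).
Proof.
move=> oA; rewrite openE => v Av; have [V [oV]] := oA _ Av.
rewrite tgt_seg => Vv VA; have [e e0 eV] := seg_near (@chi_continuous _ _ K a) oV Vv.
apply/nbhs_ballP; exists e => // u vu; rewrite /reach /=.
rewrite -(seg_comp _ w v u); apply: VA; last by rewrite src_seg.
by apply: eV => //; exact: ballxx.
Qed.

(* [weight A y] is the value at the trivial class at [y] of a function on the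
   universal covering based at [y] whose cozero set is [A]; its value at the class
   [p] is [weight (translate p A) (tgt p)]. The fuel [n] only has to exceed the
   dimension of the cell of [y]. *)
Fixpoint weight_rec n A y : R :=
  if n isn't m.+1 then 0 else
    let w := projT2 (pcoord K y) in
    extension (depth (reach A w) w) (enorm w)
      (if w == 0 then 0
       else weight_rec m (translate (sg _ w (dir w)) A) (chi _ (dir w))).

Definition weight A y : R := weight_rec (cw_dim (cell_at K y)).+1 A y.

Lemma weight_rec_stable m n A y : (cw_dim (cell_at K y) < m)%N ->
  (cw_dim (cell_at K y) < n)%N -> weight_rec m A y = weight_rec n A y.
Proof.
elim: m n A y => // m IHm [//|n] A y; rewrite !ltnS => ym yn /=.
congr extension; case: eqP => // /eqP w0.
have dlt := @dim_chi_sphere _ _ K _ _ (dir_sphere w0).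
by apply: IHm; exact: leq_trans dlt _.
Qed.

Lemma weight_interior A a w : open_disc w -> weight A (chi a w) =
  extension (depth (reach A w) w) (enorm w)
    (if w == 0 then 0 else weight (translate (sg a w (dir w)) A) (chi a (dir w))).
Proof.
move=> dw; rewrite {1}/weight cell_atE// [LHS]/= pcoordE// [LHS]/=.
congr extension; case: eqP => // /eqP w0.
apply: weight_rec_stable => //; exact/dim_chi_sphere/dir_sphere.
Qed.

(** Moving the base point within a cell does not change the set whose depth is measured, so along
    the cell the weight follows one formula with [reach A w0] fixed. *)
Lemma weight_translate A a w0 w : open_disc w ->
  weight (translate (sg a w0 w) A) (chi a w) =
  extension (depth (reach A w0) w) (enorm w)
    (if w == 0 then 0 else weight (translate (sg a w0 (dir w)) A) (chi a (dir w))).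
Proof.
move=> dw; rewrite weight_interior// reach_translate translateA ?seg_comp//.
by rewrite tgt_seg src_seg.
Qed.

Lemma weight_idp A y : weight (translate (idp y) A) y = weight A y.
Proof.
case: (pcoordP K y); case: (pcoord K y) => a w /= dw <-.
by rewrite -(segxx (@chi_continuous _ _ K _)) weight_translate// [RHS]weight_interior.
Qed.

Lemma weight_ge0 A y : 0 <= weight A y.
Proof.
rewrite /weight /=; apply: extension_ge0; apply/discE/open_disc_disc.
by have [] := pcoordP K y.
Qed.

Lemma weight_rec_le1 n A y : weight_rec n A y <= 1.
Proof.
elim: n A y => [|n IHn] A y /=; first exact: ler01.
apply: extension_le1; last by case: ifP.
by rewrite enorm_ge0; apply/discE/open_disc_disc; have [] := pcoordP K y.
Qed.

Lemma weight_le1 A y : weight A y <= 1. Proof. exact: weight_rec_le1. Qed.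

(** Only the outermost step of the recursion matters: on the open disc an extension is positive
    exactly when the depth is, and [reach A w] is open. *)
Lemma weight_gt0 A y : end_open A -> (0 < weight A y) = `[< A (idp y) >].
Proof.
move=> oA; case: (pcoordP K y); case: (pcoord K y) => a w /= dw <-.
rewrite weight_interior// extension_gt0 ?depth_ge0//; last exact/open_discE.
apply/idP/asboolP => [/depth_gt0/nbhs_singleton|Aw].
  by rewrite /reach /= segxx.
apply/depth_gt0; apply: open_nbhs_nbhs; split; first exact: open_reach.
by rewrite /reach /= segxx.
Qed.

(** Carries the interior formula over to the sphere. There the extension returns the boundary value
    provided that a positive value comes with positive depth, and it does: a positive weight puts
    [w] into the open set [reach A w0]. *)
Lemma weight_disc A a w0 w : end_open A -> disc w ->
  weight (translate (sg a w0 w) A) (chi a w) =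
  extension (depth (reach A w0) w) (enorm w)
    (if w == 0 then 0 else weight (translate (sg a w0 (dir w)) A) (chi a (dir w))).
Proof.
move=> oA /disc_cases[|Sw]; first exact: weight_translate.
rewrite (negbTE (sphere_neq0 Sw)) dir_id//; have /sphereE -> := Sw.
rewrite extension1 ?weight_ge0// weight_gt0; last exact: end_open_translate.
move=> /asboolP[_]; rewrite compp1 ?tgt_seg// => Aw.
by apply/depth_gt0; apply: open_nbhs_nbhs; split; first exact: open_reach.
Qed.

End weight.

(** * From estimates on cells to estimates on the space *)

Section regularity.
Context {R : realType} {X : topologicalType} (K : cw_complex R X).
Hypothesis nice_basis : basis (@nice R X).
Implicit Types (A : set (Pi R X)) (p q : Pi R X) (x y z : X) (a b : cw_cell K).
Implicit Types (V : set X) (F : set (set (Pi R X))) (e : R).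

Local Notation sg a := (seg (@chi_continuous _ _ K a)).

Lemma nice_nbhs V x : open V -> V x -> exists U, [/\ nice R U, U x & U `<=` V].
Proof.
move=> oV Vx; have [_ /(_ x V)] := nice_basis.
by case=> [|U [nU Ux] UV]; [exact: open_nbhs_nbhs|exists U].
Qed.

Lemma nice_open V : nice R V -> open V. Proof. by case. Qed.

Section transfer.
Variables (s : R) (fam : set (set (set (Pi R X)))).
Hypothesis fam_translate : forall F p, fam F -> fam (translate p @` F).

(** One notion serves both semicontinuities: [s] will be 1 or -1, and the members of [fam] are the
    collections over which the estimate is uniform, namely all collections of end-open sets for the
    upper one and singletons for the lower one. *)
Definition regular_along a := forall w0 e F, disc w0 -> 0 < e -> fam F ->
  \forall w \near w0, disc w -> forall A, F A ->
    s * weight K (translate (sg a w0 w) A) (chi a w) <=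
    s * weight K A (chi a w0) + e.

(** The margin [e' < e] makes this an open condition. In a nice [V] only one class [p] qualifies for
    each [z]. *)
Let close V y F e : set X := [set z | V z /\ exists2 e', e' < e &
  forall A p, F A -> inside V p -> src p = y -> tgt p = z ->
    s * weight K (translate p A) z <= s * weight K A y + e'].

Let close_refl V y F e : nice R V -> V y -> 0 < e -> close V y F e y.
Proof.
move=> nV Vy e0; split=> //; exists 0 => // A p FA Vp py py'.
have -> : p = idp y.
  by apply: (nice_unique nV); rewrite ?src_idp ?tgt_idp//; exact: inside_idp.
by rewrite weight_idp addr0.
Qed.

Let close_open_along a V y F e : nice R V -> V y -> fam F -> regular_along a ->
  open_along a (close V y F e).
Proof.
move=> nV Vy famF ra w dw [Vw [e' e'e He']].
have [p0 [Vp0 p0y p0w]] := nice_path nV Vy Vw.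
(* Half of the slack is spent on passing from [w] to a nearby point, so that a margin remains. *)
have d0 : 0 < (e - e') / 2 by rewrite divr_gt0// subr_gt0.
have /nbhs_ballP[e1 /= e10 H1] := ra w _ _ dw d0 (fam_translate p0 famF).
have [e2 e20 H2] := seg_near (@chi_continuous _ _ K a) (nice_open nV) Vw.
near=> v => dv.
have w1v : ball w e1 v by near: v; exact: nbhsx_ballx.
have w2v : ball w e2 v by near: v; exact: nbhsx_ballx.
have Vwv := H2 _ _ (ballxx w e20) w2v.
split; first by have [] := inside_ends Vwv; rewrite tgt_seg.
exists (e' + (e - e') / 2); first by lra.
move=> A p FA Vp py pv.
have -> : p = compose p0 (sg a w v).
  have p0E : tgt p0 = src (sg a w v) by rewrite src_seg.
  by apply: (nice_unique nV); rewrite ?src_comp ?tgt_comp ?tgt_seg ?py//;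
    exact: inside_comp.
rewrite -translateA ?src_seg//.
have := H1 v w1v dv (translate p0 A) (imageP _ FA).
by have := He' A p0 FA Vp0 p0y p0w; lra.
Unshelve. all: by end_near. Qed.

(** Points of the sphere near [w0] may lie in several lower cells; [sphere_near], applied to
    [close], combines the estimates known along each of them. *)
Lemma regular_sphere a : (forall b, (cw_dim b < cw_dim a)%N -> regular_along b) ->
  forall w0 e F, sphere w0 -> 0 < e -> fam F ->
  \forall w \near w0, sphere w -> forall A, F A ->
    s * weight K (translate (sg a w0 w) A) (chi a w) <=
    s * weight K A (chi a w0) + e.
Proof.
move=> rb w0 e F Sw0 e0 famF.
have [V [nV Vw0 _]] := nice_nbhs openT (I : setT (chi a w0)).
have := sphere_near (fun b ba => close_open_along (e := e) nV Vw0 famF (rb b ba))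
  Sw0 (close_refl F nV Vw0 e0).
have [e2 e20 H2] := seg_near (@chi_continuous _ _ K a) (nice_open nV) Vw0.
move=> nw; near=> w => Sw A FA.
have w0w : ball w0 e2 w by near: w; exact: nbhsx_ballx.
have [Vw [e' e'e He']] : close V (chi a w0) F e (chi a w) by move: Sw; near: w.
have := He' A _ FA (H2 _ _ (ballxx w0 e20) w0w) (src_seg _ _ _) (tgt_seg _ _ _).
by lra.
Unshelve. all: by end_near. Qed.

(** The set [close] is open along every cell, hence open, and a nice neighbourhood inside it
    serves. *)
Lemma regular_nbhs : (forall a, regular_along a) ->
  forall y e F, 0 < e -> fam F -> exists U, [/\ nice R U, U y &
    forall A p, F A -> inside U p -> src p = y ->
      s * weight K (translate p A) (tgt p) <= s * weight K A y + e].
Proof.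
move=> ra y e F e0 famF.
have [V [nV Vy _]] := nice_nbhs openT (I : setT y).
have oO : open (close V y F e).
  by apply: (weak_open (K := K)) => a; exact: close_open_along.
have [U [nU Uy UO]] := nice_nbhs oO (close_refl F nV Vy e0).
exists U; split=> // A p FA Up py.
have UV : U `<=` V by move=> z /UO[].
have [_ [e' e'e He']] := UO _ (inside_ends Up).2.
by have := He' A p FA (inside_sub UV Up) py erefl; lra.
Qed.

End transfer.

End regularity.

Section near_vector.
Context {R : realType} {n : nat}.

Lemma near_enorm (w0 : 'rV[R]_n) (h : R) : 0 < h ->
  \forall w \near w0, `|enorm w - enorm w0| < h.
Proof.
move=> h0; have := @enorm_continuous R n w0.
by move=> /cvgrPdist_lt/(_ h h0); apply: filterS => w; rewrite distrC.
Qed.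

Lemma near_depth (w0 : 'rV[R]_n) (h : R) : 0 < h ->
  \forall w \near w0, forall A : set 'rV[R]_n, `|depth A w - depth A w0| < h.
Proof.
move=> h0; near=> w => A; rewrite ltr_distl.
have /= ww : `|w0 - w| < h by near: w; exact: cvgr_dist_lt.
apply/andP; split.
  by rewrite ltrBlDr; apply: le_lt_trans (depth_lipschitz A w0 w) _; rewrite ltrD2l.
by apply: le_lt_trans (depth_lipschitz A w w0) _; rewrite ltrD2l distrC.
Unshelve. all: by end_near. Qed.

Lemma near_dir (w0 : 'rV[R]_n) (P : set 'rV[R]_n) : w0 != 0 ->
  (\forall v \near dir w0, sphere v -> P v) ->
  \forall w \near w0, w != 0 /\ P (dir w).
Proof.
move=> w00 nP; have nz : \forall w \near w0, w != 0.
  have : nbhs w0 (~` [set 0]).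
    apply: open_nbhs_nbhs; split; last exact/eqP.
    apply: closed_openC; apply: accessible_closed_set1.
    exact/hausdorff_accessible/norm_hausdorff.
  by apply: filterS => w /eqP.
have nd : \forall w \near w0, sphere (dir w) -> P (dir w) := dir_continuous w00 nP.
by apply: filterS2 nz nd => w wn0 Pw; split=> //; exact/Pw/dir_sphere.
Qed.

End near_vector.

Lemma cell_induction {R : realType} {X : topologicalType} (K : cw_complex R X)
  (P : cw_cell K -> Prop) :
  (forall a, (forall b, (cw_dim b < cw_dim a)%N -> P b) -> P a) -> forall a, P a.
Proof.
move=> step a; move: (leqnn (cw_dim a)); move: {2}(cw_dim a) => n.
elim: n a => [|n IHn] a an; apply: step => b ba; last first.
  by apply: IHn; rewrite -ltnS; exact: leq_trans an.
by have := leq_trans ba an; rewrite ltn0.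
Qed.

Section semicontinuity.
Context {R : realType} {X : topologicalType} (K : cw_complex R X).
Hypothesis nice_basis : basis (@nice R X).
Implicit Types (A : set (Pi R X)) (p q : Pi R X) (x y z : X) (a b : cw_cell K).
Implicit Types (F : set (set (Pi R X))) (e : R).

Local Notation sg a := (seg (@chi_continuous _ _ K a)).

Let all_open F := F `<=` end_open.
Let one_open F := exists2 A, end_open A & F = [set A].

Let all_open_translate F p : all_open F -> all_open (translate p @` F).
Proof. by move=> oF _ [A FA <-]; exact/end_open_translate/oF. Qed.

Let one_open_translate F p : one_open F -> one_open (translate p @` F).
Proof.
move=> [A oA ->]; exists (translate p A); first exact: end_open_translate.
by rewrite image_set1.
Qed.

(** The values at radial projections grow by at most [e / 2] thanks to the lower cells, the depth
    varies uniformly in [A], and [extension_usc] combines the two. *)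
Let usc_step a :
  (forall b, (cw_dim b < cw_dim a)%N -> regular_along 1 all_open b) ->
  @regular_along _ _ K 1 all_open a.
Proof.
move=> rb w0 e F dw0 e0 oF.
have r0 : 0 <= enorm w0 <= 1 by rewrite enorm_ge0; apply/discE.
have [h h0 H] := extension_usc r0 e0.
have S2 : 0 < e / 2 by exact: divr_gt0.
(* Radial projection breaks down at the origin, but near it [1 / 2 < enorm w] fails and nothing is
   to be shown. *)
have nd : \forall w \near w0, 1 / 2 < enorm w -> w0 != 0 /\ w != 0 /\
    forall A, F A -> weight K (translate (sg a w0 (dir w)) A) (chi a (dir w)) <=
    weight K (translate (sg a w0 (dir w0)) A) (chi a (dir w0)) + e / 2.
  have [w00|w00] := eqVneq w0 0.
    have := near_enorm w0 (_ : 0 < 1 / 2 :> R); rewrite w00 enorm0 => /(_ ltac:(lra)).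
    by apply: filterS => w; rewrite subr0 ger0_norm ?enorm_ge0//; lra.
  have := regular_sphere nice_basis all_open_translate rb (dir_sphere w00) S2
    (all_open_translate (p := sg a w0 (dir w0)) oF).
  move=> /(near_dir w00); apply: filterS => w [wn0 Hw] _; split=> //; split=> // A FA.
  have := Hw _ (imageP _ FA); rewrite !mul1r translateA ?seg_comp//.
  by rewrite tgt_seg src_seg.
have nr := near_enorm w0 h0.
have ndp := near_depth w0 h0.
apply: filterS3 nd nr ndp => w near_g near_r near_d dw A FA; rewrite !mul1r.
rewrite (weight_disc w0)//; last exact: oF.
have -> : weight K A (chi a w0) = weight K (translate (sg a w0 w0) A) (chi a w0).
  by rewrite segxx weight_idp.
rewrite (weight_disc w0 (oF _ FA) dw0).
have dpt B := depth_le B w.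
apply: H => //.
- exact: depth_ge0.
- exact/discE.
- by case: ifP => // _; exact: weight_ge0.
- by case: ifP => // _; exact: weight_le1.
- case: ifPn => [_|w00]; first by rewrite ltxx.
  rewrite weight_gt0; last exact/end_open_translate/oF.
  move=> /asboolP[_]; rewrite compp1 ?tgt_seg// => Aw r1.
  apply/depth_gt0; apply: open_nbhs_nbhs; split; first exact/open_reach/oF.
  by rewrite /reach /= -{2}(dir_id (_ : sphere w0))//; exact/sphereE.
- by have := near_d (reach A w0); rewrite ltr_distl => /andP[_ /ltW].
- by move=> /near_g[w00 [wn0]]; rewrite (negbTE w00) (negbTE wn0); exact.
Qed.

Let lsc_step a :
  (forall b, (cw_dim b < cw_dim a)%N -> regular_along (-1) one_open b) ->
  @regular_along _ _ K (-1) one_open a.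
Proof.
move=> rb w0 e F dw0 e0 [A oA FE].
have r0 : 0 <= enorm w0 <= 1 by rewrite enorm_ge0; apply/discE.
have d0 : 0 <= depth (reach A w0) w0 <= 1 / 2 by rewrite depth_ge0 depth_le.
have [h h0 H] := extension_lsc d0 r0 e0.
have S2 : 0 < e / 2 by exact: divr_gt0.
have nd : \forall w \near w0, 0 < enorm w0 -> w0 != 0 /\ w != 0 /\
    weight K (translate (sg a w0 (dir w0)) A) (chi a (dir w0)) - e / 2 <=
    weight K (translate (sg a w0 (dir w)) A) (chi a (dir w)).
  have [->|w00] := eqVneq w0 0; first by apply: filterE => w; rewrite enorm0 ltxx.
  have oF : one_open F by exists A.
  have := regular_sphere nice_basis one_open_translate rb (dir_sphere w00) S2
    (one_open_translate (sg a w0 (dir w0)) oF).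
  move=> /(near_dir w00); apply: filterS => w [wn0 Hw] _; split=> //; split=> //.
  have FA : F A by rewrite FE.
  have := Hw _ (imageP _ FA); rewrite !mulN1r translateA ?tgt_seg ?src_seg// seg_comp.
  by lra.
have nr := near_enorm w0 h0.
have ndp := near_depth w0 h0.
apply: filterS3 nd nr ndp => w near_g near_r near_d dw B; rewrite FE => ->.
rewrite !mulN1r.
rewrite (weight_disc w0)//.
have -> : weight K A (chi a w0) = weight K (translate (sg a w0 w0) A) (chi a w0).
  by rewrite segxx weight_idp.
rewrite (weight_disc w0 oA dw0) lerNl opprD opprK.
apply: H => //.
- exact/discE.
- by case: ifP => // _; exact: weight_le1.
- by move=> /near_g[w00 [wn0]]; rewrite (negbTE w00) (negbTE wn0).
Qed.

(* The estimate is uniform in [A]: this is what makes suprema of weights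
   continuous. *)
Lemma weight_usc y e : 0 < e -> exists U, [/\ nice R U, U y &
  forall A p, end_open A -> inside U p -> src p = y ->
    weight K (translate p A) (tgt p) <= weight K A y + e].
Proof.
move=> e0; have [|U [nU Uy HU]] := regular_nbhs nice_basis all_open_translate
    (cell_induction usc_step) y e0 (_ : all_open end_open); first by [].
by exists U; split=> // A p oA Up py; have := HU A p oA Up py; rewrite !mul1r.
Qed.

Lemma weight_lsc y A e : end_open A -> 0 < e -> exists U, [/\ nice R U, U y &
  forall p, inside U p -> src p = y ->
    weight K A y - e <= weight K (translate p A) (tgt p)].
Proof.
move=> oA e0; have [|U [nU Uy HU]] := regular_nbhs nice_basis one_open_translate
    (cell_induction lsc_step) y e0 (_ : one_open [set A]); first by exists A.
exists U; split=> // p Up py; have := HU A p erefl Up py; rewrite !mulN1r; lra.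
Qed.

End semicontinuity.

(** * Open sets of path classes as cozero sets *)

Section cozero.
Context {R : realType} {X : topologicalType} (K : cw_complex R X).
Hypothesis nice_basis : basis (@nice R X).
Implicit Types (A B : set (Pi R X)) (p q u v : Pi R X) (x y : X).

Lemma inv_comp p q : tgt p = src q -> inv (compose p q) = compose (inv q) (inv p).
Proof.
move=> pq; rewrite -[RHS](@compKV _ _ (compose p q)); last first.
  by rewrite src_comp ?tgt_comp ?src_inv ?tgt_inv.
rewrite -compA ?tgt_comp ?src_comp ?src_inv ?tgt_inv//; last first.
rewrite (compA (p := q)) ?src_inv ?tgt_inv// comppV comp1p ?src_inv//.
by rewrite comppV compp1// tgt_inv src_comp.
Qed.

(** The factors [u] and [v] cancel against their inverses. This moves a pair admissible for
    [compose (compose u p) v] to one admissible for [p]. *)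
Lemma conj_shift u v a b p : tgt u = src p -> src v = tgt p ->
  src a = src p -> src b = tgt p ->
  compose (compose (inv (compose u a)) (compose (compose u p) v)) (compose (inv v) b) =
  compose (compose (inv a) p) b.
Proof.
move=> up vp ap bp.
have ua : tgt u = src a by rewrite ap.
rewrite inv_comp// -(compA (p := inv a)); last 2 first.
- by rewrite tgt_inv src_inv.
- by rewrite tgt_inv src_comp ?src_comp// tgt_comp.
rewrite -(compA (p := u)) ?vp// compKV; last by rewrite src_comp.
rewrite -(compA (p := inv a)) ?src_comp ?tgt_inv//.
rewrite -(compA (p := inv a)) ?tgt_inv ?src_comp ?tgt_comp ?src_inv//.
rewrite -(compA (p := p)) ?src_comp ?src_inv ?tgt_inv//; last by rewrite bp.
  by rewrite compVK ?vp// -?compA ?tgt_inv.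
- by rewrite tgt_comp ?src_inv.
- by rewrite vp.
Qed.

Lemma Pi_basic_open U V p : nice R U -> nice R V -> U (src p) -> V (tgt p) ->
  open_nbhs p (Pi_basic U V (repr p)).
Proof.
move=> nU nV Up Vp; have [bo _] := basis_Pi_basis nice_basis.
split; first by apply: bo; exists U, V, (repr p).
by have := @Pi_basic_refl _ _ U V (repr p) Up Vp; rewrite [path_class _]reprK.
Qed.

Lemma Pi_basic_sub_open (W : set (Pi R X)) p : open W -> W p ->
  exists U V, [/\ nice R U, nice R V, U (src p), V (tgt p) &
    Pi_basic U V (repr p) `<=` W].
Proof.
move=> oW Wp; have [_ /(_ p W)] := basis_Pi_basis nice_basis.
case=> [|_ [[U [V [g [nU nV Ug Vg ->]]]] Sp] SW]; first exact: open_nbhs_nbhs.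
have pE : path_class (repr p) = p by exact: reprK.
have [Up Vp] : U (src p) /\ V (tgt p) by apply: (@Pi_basic_ends _ _ U V g); rewrite pE.
exists U, V; split=> // q Sq; apply: SW.
by apply: (@Pi_basic_sub _ _ U V U V g (repr p)) => //; rewrite pE.
Qed.

Variable W : set (Pi R X).

Let admissible p A B := [/\ end_open A, end_open B & forall u v, A u -> B v ->
  src u = src p -> src v = tgt p -> W (compose (compose (inv u) p) v)].

Let admissible_move p q u v A B : tgt u = src p -> src v = tgt p ->
  q = compose (compose u p) v -> admissible q A B ->
  admissible p (translate u A) (translate (inv v) B).
Proof.
move=> up vp -> [oA oB AB].
split; [exact: end_open_translate|exact: end_open_translate|].
move=> a b [_ Aa] [_ Bb] ap bp.
rewrite -(conj_shift up vp ap bp); apply: AB => //.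
- by rewrite src_comp ?src_comp ?tgt_comp ?ap.
- by rewrite src_comp ?src_inv ?tgt_comp ?tgt_inv ?bp// tgt_comp.
Qed.

Let values p := [set r | r = 0 \/ exists A B, admissible p A B /\
  r = Num.min (weight K A (src p)) (weight K B (tgt p))].

Definition cozero_fun p : R := sup (values p).

Let values_sup p : has_sup (values p).
Proof.
split; first by exists 0; left.
exists 1 => r [->|[A [B [_ ->]]]]; first exact: ler01.
by rewrite ge_min weight_le1.
Qed.

Let cozero_ub p A B : admissible p A B ->
  Num.min (weight K A (src p)) (weight K B (tgt p)) <= cozero_fun p.
Proof.
move=> AB; apply: ub_le_sup; first by have [] := values_sup p.
by right; exists A, B.
Qed.

Lemma cozero_ge0 p : 0 <= cozero_fun p.
Proof. by apply: ub_le_sup; [have [] := values_sup p|left]. Qed.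

Lemma end_open_inside U : open U -> end_open (inside U : set (Pi R X)).
Proof.
move=> oU p Up; exists U; split=> //; first by have [] := inside_ends Up.
by move=> q Uq qp; exact: inside_comp.
Qed.

(** A positive value gives admissible sets containing the trivial classes, and these yield [W p].
    Conversely, if the basic neighbourhood given by [U] and [V] lies in [W], then [inside U] and
    [inside V] are admissible. *)
Lemma cozero_gt0 p : open W -> 0 < cozero_fun p <-> W p.
Proof.
move=> oW; split.
  move=> /(@sup_gt _ (values p))[|r [->|[A [B [[oA oB AB] ->]]]]].
  - by exists 0; left.
  - by rewrite ltxx.
  rewrite lt_min !weight_gt0// => /andP[/asboolP Ap /asboolP Bp].
  have := AB _ _ Ap Bp; rewrite !src_idp => /(_ erefl erefl).
  have -> : inv (idp (src p)) = idp (src p) :> Pi R X.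
    by rewrite -[LHS](@comp1p _ _ (src p)) ?comppV ?src_inv ?tgt_idp ?src_idp.
  by rewrite comp1p// compp1.
move=> Wp; have [U [V [nU nV Up Vp UV]]] := Pi_basic_sub_open oW Wp.
have oU : open U by case: nU.
have oV : open V by case: nV.
have AB : admissible p (inside U) (inside V).
  split; [exact: end_open_inside|exact: end_open_inside|].
  move=> u v Uu Vv up vp; apply: UV; apply/Pi_basicE => //.
  by exists (inv u), v; rewrite tgt_inv; split=> //; exact: inside_inv.
apply: lt_le_trans (cozero_ub AB); rewrite lt_min !weight_gt0; last 2 first.
- exact: end_open_inside.
- exact: end_open_inside.
by apply/andP; split; apply/asboolP; exact: inside_idp.
Qed.

Let weight_translateVK p u A : tgt u = src p ->
  weight K (translate (inv u) (translate u A)) (src u) = weight K A (src u).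
Proof. by move=> up; rewrite translateA ?src_inv// comppV weight_idp. Qed.

Lemma cozero_continuous : continuous cozero_fun.
Proof.
move=> p; apply/(@cvgrPdist_le _ _ _ (nbhs p) (nbhs_filter p)) => /= e e0.
have [U1 [nU1 U1p HU1]] := weight_usc K nice_basis (src p) e0.
have [V1 [nV1 V1p HV1]] := weight_usc K nice_basis (tgt p) e0.
have d0 : 0 < e / 2 by exact: divr_gt0.
have [r [vr rsup]] : exists r, values p r /\ cozero_fun p - e / 2 < r.
  by have [r] := sup_adherent d0 (values_sup p); exists r.
(* One almost optimal pair for [p] is moved to [q]; as it is fixed, lower semicontinuity for single
   sets suffices. *)
have lsc : \forall q \near p, r - e / 2 <= cozero_fun q.
  case: vr => [->|[A [B [AB ->]]]].
    by apply: filterE => q; have := cozero_ge0 q; lra.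
  have [oA oB _] := AB.
  have [U2 [nU2 U2p HU2]] := weight_lsc K nice_basis (src p) oA d0.
  have [V2 [nV2 V2p HV2]] := weight_lsc K nice_basis (tgt p) oB d0.
  have := open_nbhs_nbhs (Pi_basic_open nU2 nV2 U2p V2p).
  apply: filterS => q /(Pi_basicE _ U2p V2p)[u [v [Uu Vv up vp qE]]].
  have srcq : src q = src u by rewrite qE !src_comp ?tgt_comp.
  have tgtq : tgt q = tgt v by rewrite qE !tgt_comp.
  have pE : p = compose (compose (inv u) q) (inv v).
    rewrite qE -(compA (p := u)) ?vp// compKV ?src_comp ?vp//.
    by rewrite -compA ?src_inv ?vp// comppV compp1 ?vp.
  have := admissible_move (u := inv u) (v := inv v) (p := q) (A := A) (B := B).
  rewrite tgt_inv src_inv srcq tgtq invK => /(_ p erefl erefl pE AB)/cozero_ub.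
  rewrite srcq tgtq; apply: le_trans.
  have := HU2 _ (inside_inv Uu); rewrite src_inv tgt_inv => /(_ up) Hu.
  have := HV2 _ Vv vp => Hv.
  by rewrite le_min !lerBlDr !ge_min -!lerBlDr Hu Hv orbT.
(* An arbitrary pair for [q] is moved back to [p]. It varies with [q], so the neighbourhood must not
   depend on the pair: here the uniform estimate enters. *)
have usc : \forall q \near p, cozero_fun q <= cozero_fun p + e.
  have := open_nbhs_nbhs (Pi_basic_open nU1 nV1 U1p V1p).
  apply: filterS => q /(Pi_basicE _ U1p V1p)[u [v [Uu Vv up vp qE]]].
  have srcq : src q = src u by rewrite qE !src_comp ?tgt_comp.
  have tgtq : tgt q = tgt v by rewrite qE !tgt_comp.
  apply: ge_sup; first by exists 0; left.
  move=> _ [->|[A [B [AB ->]]]]; first by have := cozero_ge0 p; lra.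
  have := cozero_ub (admissible_move up vp qE AB).
  have [oA oB _] := AB.
  have := HU1 _ (inv u) (end_open_translate (p := u) oA) (inside_inv Uu).
  rewrite src_inv tgt_inv => /(_ up); rewrite (weight_translateVK _ up) => Hu.
  have := HV1 _ v (end_open_translate (p := inv v) oB) Vv vp.
  rewrite translateA ?tgt_inv// compVp weight_idp => Hv Hmin.
  rewrite srcq tgtq -lerBlDr; apply: le_trans Hmin.
  by rewrite le_min !lerBlDr !ge_min Hu Hv orbT.
apply: filterS2 usc lsc => q Hu Hl; rewrite ler_distl; apply/andP; split; lra.
Qed.

End cozero.

(** * Nice neighbourhoods *)

Section compactness.
Context {R : realType} {X : topologicalType} (K : cw_complex R X).
Local Notation I := (unit_interval R).
Implicit Types (f : path_space R X) (a b : cw_cell K).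

Lemma compact_unit_interval : compact [set: I].
Proof.
rewrite (_ : [set: I] = @to_unit R @` `[0, 1]%classic).
  apply: continuous_compact; last exact: segment_compact.
  exact/continuous_subspaceT/to_unit_continuous.
apply/seteqP; split=> // t _; exists (\val t); last exact: to_unitK.
by rewrite /= in_itv /=; exact: unit_val_itv.
Qed.

Lemma closed_eq_fun {T Y : topologicalType} (g h : T -> Y) :
  hausdorff_space Y -> continuous g -> continuous h ->
  closed [set t | g t = h t].
Proof.
move=> hY cg ch; rewrite -[X in closed X]setCK; apply: open_closedC.
rewrite openE => t /= gh; move: hY; rewrite open_hausdorff.
move=> /(_ (g t) (h t)) [|[A B] /= [gA hB] [oA oB AB]]; first exact/eqP.
have gA' : nbhs t (g @^-1` A).
  by apply: cg; apply: open_nbhs_nbhs; split=> //; exact/set_mem.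
have hB' : nbhs t (h @^-1` B).
  by apply: ch; apply: open_nbhs_nbhs; split=> //; exact/set_mem.
apply: filterS2 gA' hB' => s As Bs /= gh'.
by have : (A `&` B) (g s); [split=> //; rewrite gh'|rewrite (eqP AB)].
Qed.

(** The tube lemma, in the form of near coverings of a compact set. *)
Lemma closed_projection {T Y : topologicalType} (D : set Y) (C : set (T * Y)) :
  compact D -> closed C -> closed [set t | exists2 y, D y & C (t, y)].
Proof.
move=> cD cC; rewrite -[X in closed X]setCK; apply: open_closedC.
rewrite openE => t nt.
suff nC : \forall t' \near t, D `<=` (fun y => ~ C (t', y)).
  by apply: filterS nC => t' H [y Dy Cy]; exact: H Cy.
move/compact_near_coveringP : cD; apply => y Dy.
have : nbhs (t, y) (~` C).
  apply: open_nbhs_nbhs; split; first exact: closed_openC.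
  by move=> Cty; apply: nt; exists y.
move=> [[P Q] /= [tP yQ] PQ]; exists (Q, P) => //= -[y' t'] [/= Qy' Pt'] Cy'.
exact: (PQ (t', y')).
Qed.

(** Otherwise choose parameters [t n] with values in distinct cells, and a cluster point [t0]. The
    values other than [f t0] form a closed set, so [f (t n) = f t0] for infinitely many [n], against
    distinctness. *)
Lemma path_finite f :
  exists2 F : set (cw_cell K), finite_set F & forall t, F (cell_at K (f t)).
Proof.
exists [set cell_at K (f t) | t in [set: I]]; last by move=> t; exists t.
apply: contrapT => /infiniteP/card_leP[c].
have cP n : exists t, cell_at K (f t) = \val (c (to_setT n)).
  by have /set_mem[t _ <-] := valP (c (to_setT n)); exists t.
have [t tE] := choice cP.
have cinj m n : cell_at K (f (t m)) = cell_at K (f (t n)) -> m = n.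
  rewrite !tE => /val_inj/(@inj _ _ _ c); rewrite !inE.
  by move=> /(_ Logic.I Logic.I)/(congr1 val).
have [t0 [_ clt]] := compact_unit_interval
  (fmap_proper_filter t eventually_filter) filterT.
pose C := [set f (t n) | n in [set n | f (t n) <> f t0]].
have oC : open (~` C).
  (* The disc of [a] meets finitely many cells [b], and [C] has at most one point, [z b], in each;
     so within the image of the disc [C] lies in a finite, hence closed, set. *)
  apply: (weak_open (K := K)) => a w dw Cw.
  have [F fF FP] := disc_finite a.
  pose z b := xget (f zero) [set x | C x /\ cell_at K x = b].
  have zE x : C x -> z (cell_at K x) = x.
    move=> Cx; rewrite /z; case: xgetP => [y -> [Cy]|/(_ x)]; last by case.
    case: Cx Cy => [m _ <-] [n _ <-]; by move=> /cinj ->.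
  have cG : closed (C `&` (z @` F)).
    have /accessible_finite_set_closed := hausdorff_accessible (cw_hausdorff K).
    by apply; exact/finite_setIr/finite_image.
  have : nbhs w (chi a @^-1` (~` (C `&` z @` F))).
    apply: chi_continuous; apply: open_nbhs_nbhs; split; first exact: closed_openC.
    by move=> [/Cw].
  apply: filterS => v nv dv Cv; apply: nv; split=> //.
  by exists (cell_at K (chi a v)); [exact: FP|exact: zE].
have nt0 : nbhs t0 (f @^-1` (~` C)).
  apply: path_continuous; apply: open_nbhs_nbhs; split=> //.
  by move=> [n /= fn] /fn.
have tail N : exists2 n, (N <= n)%N & f (t n) = f t0.
  have : \forall n \near \oo, (N <= n)%N by exists N.
  move=> nN.
  have /clt/(_ nt0)[_ [[n Nn <-] nC]] : (t @ \oo) (t @` [set n | (N <= n)%N]).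
    by apply: filterS nN => n Nn; exists n.
  by exists n => //; apply: contrapT => fn; apply: nC; exists n.
have [m _ fm] := tail 0%N; have [n mn fn] := tail m.+1.
have : m = n by apply: cinj; rewrite fm fn.
by move=> mE; rewrite mE ltnn in mn.
Qed.

Lemma path_dim f : exists n, forall t, (cw_dim (cell_at K (f t)) <= n)%N.
Proof.
have [F fF FP] := path_finite f.
have /finite_fsetP[D DE] := finite_image (@cw_dim _ _ K) fF.
exists (\max_(n <- finmap.enum_fset D) n) => t; apply: leq_bigmax_seq => //.
have : (@cw_dim _ _ K @` F) (cw_dim (cell_at K (f t))) by exists (cell_at K (f t)).
by rewrite DE.
Qed.

End compactness.

(** * Pushing loops to lower skeleta *)

Section push.
Context {R : realType} {X : topologicalType} (K : cw_complex R X).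
Local Notation I := (unit_interval R).
Implicit Types (f : path_space R X) (a b : cw_cell K) (s : R) (x : X).

(* Stretches the cells of dimension [n] radially; at time 1 the points of norm at
   least 1/2 reach the boundary. *)
Definition push n s x : X :=
  let w := projT2 (pcoord K x) in
  if cw_dim (cell_at K x) == n then chi _ ((1 + s) *: w) else x.

(** The formula covers the boundary too: such a point lies in a lower cell and stays fixed, and
    [chi] retracts the stretched vector back to it. *)
Lemma push_chi n s b (w : 'rV[R]_(cw_dim b)) : 0 <= s -> disc w ->
  (cw_dim b <= n)%N ->
  push n s (chi b w) = chi b ((if cw_dim b == n then 1 + s else 1) *: w).
Proof.
move=> s0 /disc_cases[dw|Sw] bn.
  rewrite /push cell_atE//; case: ifP => _; last by rewrite scale1r.
  by rewrite pcoordE.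
have db := dim_chi_sphere Sw.
rewrite /push ifF; last by apply/negbTE; rewrite neq_ltn (leq_trans db bn).
rewrite -[RHS]chi_retract retract_disc_out.
- by rewrite -/(dir w) dir_id.
- by case: ifP => _; lra.
- by have /sphereE -> := Sw; case: ifP => _; lra.
Qed.

Lemma push0 n x : push n 0 x = x.
Proof.
rewrite /push; case: ifP => // _; rewrite addr0 scale1r.
by have [] := pcoordP K x.
Qed.

(** Continuity is claimed only along a path in the [n]-skeleton. The path meets finitely many cells,
    so the preimage of a closed set is a finite union of projections, along compact discs, of closed
    sets. *)
Lemma push_continuous n f : (forall t, (cw_dim (cell_at K (f t)) <= n)%N) ->
  continuous (fun z : R * R => push n (\val (to_unit z.2)) (f (to_unit z.1))).
Proof.
move=> fn; have [F fF FP] := path_finite K f.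
have cf : continuous (fun z : R * R => f (to_unit z.1)).
  move=> z; apply: (@continuous_comp _ _ _ (@fst R R) (fun s => f (to_unit s))).
    exact: cvg_fst.
  exact: to_unit_path_continuous.
have cs : continuous (fun z : R * R => \val (to_unit z.2)).
  move=> z; apply: (@continuous_comp _ _ _ (@snd R R) (fun s => \val (to_unit s))).
    exact: cvg_snd.
  apply: (@continuous_comp _ _ _ (@to_unit R) (\val : I -> R)).
    exact: to_unit_continuous.
  exact: unit_val_continuous.
apply/continuous_closedP => Z cZ.
pose k b (u : (R * R) * 'rV[R]_(cw_dim b)) : X :=
  chi b ((if cw_dim b == n then 1 + \val (to_unit u.1.2) else 1) *: u.2).
pose C b : set ((R * R) * 'rV[R]_(cw_dim b)) :=
  [set u | f (to_unit u.1.1) = chi b u.2] `&` (k b @^-1` Z).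
have cC b : closed (C b).
  apply: closedI.
    apply: closed_eq_fun; first exact: cw_hausdorff K.
      by move=> u; apply: (@continuous_comp _ _ _ fst
        (fun z : R * R => f (to_unit z.1)));
        [exact: cvg_fst|exact: cf].
    by move=> u; apply: (@continuous_comp _ _ _ snd (chi b));
      [exact: cvg_snd|exact: chi_continuous].
  apply: preimage_closed cZ => u _.
  apply: (@continuous_comp _ _ _ (fun u : (R * R) * 'rV[R]_(cw_dim b) =>
    (if cw_dim b == n then 1 + \val (to_unit u.1.2) else 1) *: u.2) (chi b));
    last exact: chi_continuous.
  apply: (@continuousZ R _ _ (fun u : (R * R) * 'rV[R]_(cw_dim b) =>
    if cw_dim b == n then 1 + \val (to_unit u.1.2) else 1) snd); last exact: cvg_snd.
  case: (cw_dim b == n); last exact: cst_continuous.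
  apply: (@continuousD R R _ (fun=> 1) (fun u : (R * R) * 'rV[R]_(cw_dim b) =>
    \val (to_unit u.1.2))); first exact: cst_continuous.
  by apply: (@continuous_comp _ _ _ fst (fun z : R * R => \val (to_unit z.2)));
    [exact: cvg_fst|exact: cs].
rewrite (_ : _ @^-1` _ =
  \bigcup_(b in [set b : {classic cw_cell K} | F b /\ (cw_dim b <= n)%N])
  [set z | exists2 w, disc w & C b (z, w)]).
  apply: closed_bigcup.
    by apply: sub_finite_set fF => b [].
  by move=> b _; exact: closed_projection (compact_disc) (cC b).
apply/seteqP; split=> [z Zz|z [b [Fb bn] [w dw [/= fw kw]]]].
  set y := f (to_unit z.1) in Zz.
  have [dp pE] := pcoordP K y.
  exists (cell_at K y); first by split; [exact: FP|exact: fn].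
  have dp' := open_disc_disc dp.
  exists (projT2 (pcoord K y)) => //; split; rewrite /k /=; first by rewrite pE.
  rewrite -push_chi ?pE//; first by have /andP[] := unit_val_itv (to_unit z.2).
  exact: fn.
rewrite /= fw push_chi//.
by have /andP[] := unit_val_itv (to_unit z.2).
Qed.

Lemma push_path f n : (forall t, (cw_dim (cell_at K (f t)) <= n)%N) ->
  exists g : path_space R X, forall t, g t = push n 1 (f t).
Proof.
move=> fn; have cg : continuous (fun t : I => push n 1 (f t)).
  have -> : (fun t : I => push n 1 (f t)) =
      (fun z : R * R => push n (\val (to_unit z.2)) (f (to_unit z.1))) \o
      (fun t : I => (\val t, 1)).
    by apply/funext => t;
      rewrite -[RHS]/(push n (\val (one : I)) (f (to_unit (\val t))))
        to_unitK unit_val1.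
  move=> t; apply: continuous_comp; last exact: push_continuous.
  apply: (@continuous_pair I R R (\val) (fun=> 1)); last exact: cst_continuous.
  exact: unit_val_continuous.
by exists (mkpath cg).
Qed.

(* The end points of a loop are pushed along the same path, so the classes of
   the loop and of the pushed loop are conjugate. *)
Lemma push_null n f (g : path_space R X) : f zero = f one ->
  (forall t, (cw_dim (cell_at K (f t)) <= n)%N) ->
  (forall t, g t = push n 1 (f t)) ->
  path_class g = idp (g zero) -> path_class f = idp (f zero).
Proof.
move=> f01 fn gE gnull; have cM := push_continuous fn.
set M := (fun z : R * R => _) in cM.
have ME s t : M (s, t) = push n (\val (to_unit t)) (f (to_unit s)) by [].
have v0 : \val (to_unit (0 : R)) = 0 by exact: unit_val0.
have v1 : \val (to_unit (1 : R)) = 1 by exact: unit_val1.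
have l0 (t : I) (r : R) : line ((0, r) : R * R) ((1, r) : R * R) t = (\val t, r).
  by rewrite lineE; congr (_, _) => /=; rewrite /GRing.scale /=; ring.
have l1 (t : I) (r : R) : line ((r, 0) : R * R) ((r, 1) : R * R) t = (r, \val t).
  by rewrite lineE; congr (_, _) => /=; rewrite /GRing.scale /=; ring.
have fE : path_class f = seg cM (0, 0) (1, 0).
  rewrite /seg map_PiE; apply/path_classP/homotopic_eq => t.
  by rewrite map_pathE l0 ME v0 push0 to_unitK.
have gE' : path_class g = seg cM (0, 1) (1, 1).
  rewrite /seg map_PiE; apply/path_classP/homotopic_eq => t.
  by rewrite map_pathE l0 ME v1 to_unitK.
(* The vertical sides of the square have the same image because [f] is a loop. The bottom is the
   left side, the top and the reversed right side; a trivial top leaves a class and its inverse. *)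
have tE : seg cM (0, 0) (0, 1) = seg cM (1, 0) (1, 1).
  rewrite /seg !map_PiE; apply/path_classP/homotopic_eq => t.
  by rewrite !map_pathE !l1 !ME -[to_unit 0]/zero -[to_unit 1]/one f01.
have g0 : g zero = M (0, 1) by rewrite gE ME v1.
have f0 : f zero = M (0, 0) by rewrite ME v0 push0.
rewrite fE -(seg_comp cM _ (0, 1)) -(seg_comp cM (0, 1) (1, 1)) -gE' gnull g0.
rewrite comp1p; last by rewrite src_seg !ME -[to_unit 0]/zero -[to_unit 1]/one f01.
by rewrite -(inv_seg cM (1, 0)) -tE comppV src_seg f0.
Qed.

End push.

(** * Collared neighbourhoods of a ball in a cell *)

Section collared.
Context {R : realType} {X : topologicalType} (K : cw_complex R X).
Local Notation I := (unit_interval R).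
Variables (W : set X) (e : cw_cell K) (c : 'rV[R]_(cw_dim e)) (d : R).
Hypothesis oW : open W.
Hypothesis d_gt0 : 0 < d.
Hypothesis ball_disc : ball c d `<=` @open_disc R (cw_dim e).
Hypothesis ball_W : ball c d `<=` chi e @^-1` W.
Implicit Types (f : path_space R X) (a b : cw_cell K) (y : X).

Let core : set X := chi e @` ball c d.

(* The neighbourhood is built by collaring [core] one dimension at a time: an
   interior point of a cell is added when it is close to its radial projection
   and this projection has been added before. *)
Inductive collared : X -> Prop :=
| collared_core y : core y -> collared y
| collared_step a (w : 'rV_(cw_dim a)) (h : R) : open_disc w -> w != 0 ->
    h <= 1 / 2 -> 1 - enorm w < h -> ball (dir w) h `<=` chi a @^-1` W ->
    collared (chi a (dir w)) -> collared (chi a w).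

Let step_at a (w : 'rV_(cw_dim a)) := w != 0 /\ exists h : R,
  [/\ h <= 1 / 2, 1 - enorm w < h, ball (dir w) h `<=` chi a @^-1` W &
      collared (chi a (dir w))].

Let collared_inv a (w : 'rV_(cw_dim a)) : open_disc w -> collared (chi a w) ->
  core (chi a w) \/ step_at w.
Proof.
move=> dw gw.
(* Stating the claim through [pcoord] lets the inversion change the cell without transporting
   vectors between dimensions. *)
suff : core (chi a w) \/
    (fun s : {a : cw_cell K & 'rV_(cw_dim a)} => step_at (projT2 s))
    (pcoord K (chi a w)) by rewrite pcoordE.
case: gw => [y By|b v h dv v0 h2 vh hW gv]; first by left.
by right; rewrite pcoordE//; split=> //; exists h.
Qed.

Let core_cell y : core y -> cell_at K y = e.
Proof. by case=> v cv <-; exact/cell_atE/ball_disc. Qed.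

Let core_along a (w : 'rV_(cw_dim a)) : open_disc w -> core (chi a w) ->
  \forall w' \near w, core (chi a w').
Proof.
move=> dw Bw.
pose Q := fun s : {a : cw_cell K & 'rV_(cw_dim a)} =>
  let: existT b v := s in
    @nbhs 'rV[R]_(cw_dim b) 'rV[R]_(cw_dim b) v (chi b @^-1` core).
suff : Q (pcoord K (chi a w)) by rewrite pcoordE.
case: Bw => v cv <-; rewrite pcoordE; last exact: ball_disc.
have : nbhs v (ball c d).
  by apply: open_nbhs_nbhs; split=> //; exact: ball_open.
by rewrite /Q /=; apply: filterS => u cu; exists u.
Qed.

Lemma norm_dir_sub n (w : 'rV[R]_n) : disc w -> w != 0 ->
  `|dir w - w| <= 1 - enorm w.
Proof.
move=> /discE w1 w0; rewrite -{2}(dirK w0) -{1}[dir w]scale1r -scalerBl normrZ.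
rewrite ger0_norm ?subr_ge0//.
by rewrite ler_piMr ?subr_ge0//; exact/norm_sphere/dir_sphere.
Qed.

Lemma collared_sub : collared `<=` W.
Proof.
move=> y [{}y [v cv <-]|a w h dw w0 h2 wh hW gw]; first exact: ball_W.
apply: hW; rewrite -ball_normE /=.
by apply: le_lt_trans wh; apply: norm_dir_sub => //; exact: open_disc_disc.
Qed.

(** Near [w] the projections are still collared, by [sphere_near]. With [k] half of the slack, they
    and the norm move by less than [k], so the radius [h - k] still works. *)
Let step_along a (w : 'rV_(cw_dim a)) :
  (forall b, (cw_dim b < cw_dim a)%N -> open_along b collared) ->
  disc w -> step_at w -> \forall w' \near w, disc w' -> collared (chi a w').
Proof.
move=> Hb dw [w0 [h [h2 wh hW gw]]].
pose k := (h - (1 - enorm w)) / 2.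
have k0 : 0 < k by rewrite divr_gt0// subr_gt0.
have nd : \forall w' \near w, `|dir w - dir w'| < k.
  by have := dir_continuous w0 => /cvgrPdist_lt/(_ k k0).
have ng := near_dir w0 (sphere_near Hb (dir_sphere w0) gw).
apply: filterS3 nd ng (near_enorm w k0) => v nv [v0 gv] ne dv.
case: (disc_cases dv) => [odv|Sv]; last by rewrite -[v]dir_id.
apply: (@collared_step a v (h - k)) => //.
- by rewrite ltW// ltrBlDr (le_lt_trans h2)// ltrDl.
- by move: ne; rewrite ltr_distl => /andP[+ _]; rewrite /k; lra.
move=> u vu; apply: hW; rewrite -ball_normE /= in vu *.
apply: le_lt_trans (ler_distD (dir v) _ _) _.
by rewrite -(subrKC k h) ltrD.
Qed.

Lemma open_collared : open collared.
Proof.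
apply: (weak_open (K := K)); apply: cell_induction => a Hb w dw gw.
case: (disc_cases dw) => [odw|Sw].
  have [Bw|sw] := collared_inv odw gw; last exact: step_along.
  by apply: filterS (core_along odw Bw) => v Bv _; exact: collared_core.
(* A boundary point is its own projection; [collared] lies in [W], so continuity of [chi a] supplies
   a radius. *)
apply: step_along => //; split; first exact: sphere_neq0.
have /nbhs_ballP[h /= h0 hW] : nbhs w (chi a @^-1` W).
  by apply: chi_continuous; apply: open_nbhs_nbhs; split=> //; exact: collared_sub.
exists (Num.min h (1 / 2)); rewrite dir_id//; split=> //.
- by rewrite ge_min lexx orbT.
- by have /sphereE -> := Sw; rewrite subrr lt_min h0 /=; lra.
- by move=> v wv; apply/hW/(le_ball _ wv); rewrite ge_min lexx.
Qed.

(** Each step leads to a cell of larger dimension than that of the projection, so up to the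
    dimension of [e] there is only [core]. *)
Let collared_dim y : collared y -> (cw_dim e <= cw_dim (cell_at K y))%N /\
  ((cw_dim (cell_at K y) <= cw_dim e)%N -> core y).
Proof.
elim=> [{}y By|a w h dw w0 h2 wh hW gw [IHw _]]; first by rewrite core_cell.
rewrite (cell_atE dw); have da := dim_chi_sphere (dir_sphere w0).
have ea := leq_ltn_trans IHw da.
by split; [exact: ltnW|rewrite leqNgt ea].
Qed.

(** Go radially to the sphere: the points in between have the same projection and are nearer to it,
    so the same [h] serves. Continue from the projection by induction. *)
Lemma collared_core_path y : collared y ->
  exists p : Pi R X, [/\ inside collared p, src p = y & tgt p = chi e c].
Proof.
elim=> [_ [v cv <-]|a w h dw w0 h2 wh hW gw [p [gp pw pc]]].
  exists (seg (@chi_continuous _ _ K e) v c); rewrite src_seg tgt_seg; split=> //.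
  apply: (@inside_seg _ _ _ _ _ _ (ball c d)).
    by apply: line_ball => //; exact: ballxx.
  by move=> u cu; apply: collared_core; exists u.
exists (compose (seg (@chi_continuous _ _ K a) w (dir w)) p).
rewrite src_comp ?tgt_comp ?tgt_seg// src_seg; split=> //.
apply: inside_comp; rewrite ?tgt_seg//.
apply: (@inside_seg _ _ _ _ _ _ [set u | collared (chi a u)]) => // t.
rewrite lineE /mkset; have /andP[t0 t1] := unit_val_itv t.
have [->|tn1] := eqVneq (\val t) 1; first by rewrite subrr scale0r add0r scale1r.
have tlt : \val t < 1 by rewrite lt_def eq_sym tn1.
have r0 := enorm_gt0 w0; have /open_discE r1 := dw.
set s := (1 - \val t) * enorm w + \val t.
have -> : (1 - \val t) *: w + \val t *: dir w = (s / enorm w) *: w.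
  rewrite /dir scalerA -scalerDl; congr (_ *: _); rewrite /s mulrDl mulfK//.
  exact: lt0r_neq0.
have t1r : 0 < (1 - \val t) * enorm w by rewrite mulr_gt0// subr_gt0.
have t1r' : 0 < (1 - \val t) * (1 - enorm w) by rewrite mulr_gt0// subr_gt0.
have t2r : 0 <= \val t * (1 - enorm w) by rewrite mulr_ge0// subr_ge0 ltW.
have s0 : 0 < s by rewrite /s; lra.
have sr0 : 0 < s / enorm w by rewrite divr_gt0.
have es : enorm ((s / enorm w) *: w) = s.
  by rewrite enormZ gtr0_norm// divfK// lt0r_neq0.
apply: (@collared_step a _ h); rewrite ?dirZ//.
- apply/open_discE; rewrite es /s; lra.
- by rewrite scaler_eq0 negb_or w0 andbT lt0r_neq0.
- by rewrite es; apply: le_lt_trans wh; rewrite /s; lra.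
Qed.

Lemma collared_path_connected : path_connected R collared.
Proof.
move=> x y gx gy.
have [p [gp px pc]] := collared_core_path gx.
have [q [gq qy qc]] := collared_core_path gy.
have pq : tgt p = src (inv q) by rewrite src_inv pc qc.
have [f fE gf] := inside_comp pq gp (inside_inv gq).
exists f; split=> //.
  by rewrite -(srcE f) -fE src_comp.
by rewrite -(tgtE f) -fE tgt_comp// tgt_inv.
Qed.

(** The characteristic map is a homeomorphism on the open disc, so the loop lifts to a loop in a
    ball, which contracts along segments. *)
Let core_null f : path_in core f -> f zero = f one ->
  path_class f = idp (f zero).
Proof.
move=> Bf f01.
have /choice[v vP] : forall t, exists u, ball c d u /\ chi e u = f t.
  by move=> t; have [u cu fu] := Bf t; exists u.
have dv t : open_disc (v t) by apply: ball_disc; have [] := vP t.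
have fE t : f t = cw_map (v t).
  by have [_ <-] := vP t; rewrite chiE//; exact: open_disc_disc.
have vinj s t : f s = f t -> v s = v t.
  by rewrite !fE => /(@cw_map_inj _ _ K e); rewrite !inE; apply.
have cv : continuous v.
  apply/continuousP => O oO.
  have oOd : open (O `&` @open_disc R (cw_dim e)).
    by apply: openI => //; exact: open_open_disc.
  have [Q oQ OE] := @cw_map_open _ _ K e _ oOd (@subIsetr _ _ _).
  have := (continuousP (fun_of_path f)).1 (@path_continuous _ _ f) _ oQ.
  congr open; apply/seteqP; split=> t /=.
    move=> Qt; have : (Q `&` open_cell e) (f t).
      by split=> //; rewrite fE; exists (v t).
    rewrite -OE => -[u [Ou du] uE].
    suff -> : v t = u by [].
    by apply: (@cw_map_inj _ _ K e); rewrite ?inE//; rewrite uE fE.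
  move=> Ot; have : (@cw_map _ _ _ e @` (O `&` @open_disc R (cw_dim e))) (f t).
    by rewrite fE; exists (v t).
  by rewrite OE => -[].
apply/path_classP; apply: (@convex_homotopic _ _ _ (chi e) v (fun=> v zero)).
- exact: chi_continuous.
- exact: cv.
- exact: cst_continuous.
- by [].
- exact: vinj.
- by move=> t; have [_ ->] := vP t.
- by move=> t; have [_ ->] := vP zero.
Qed.

(** Induction on a bound for the dimensions of the cells met. Pushing sends each point in a top cell
    to its projection, which is collared by construction; the descent stops at the dimension of [e],
    where the loop lies in [core]. *)
Lemma collared_null f : path_in collared f -> f zero = f one ->
  path_class f = idp (f zero).
Proof.
have [n fn] := path_dim K f; elim: n f fn => [|n IHn] f fn gf f01.
  apply: core_null => // t; have [et +] := collared_dim (gf t); apply.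
  exact: leq_trans (fn t) _.
have [ne|en] := leqP n.+1 (cw_dim e).
  apply: core_null => // t; have [et +] := collared_dim (gf t); apply.
  exact: leq_trans (fn t) _.
have [g gE] := push_path fn.
have gP t : (cw_dim (cell_at K (g t)) <= n)%N /\ collared (g t).
  rewrite gE /push; have := gf t; have := fn t.
  case: (pcoordP K (f t)); rewrite /cell_at; case: (pcoord K (f t)) => a w /= dw <-.
  rewrite leq_eqVlt => /orP[an|an] gw; last first.
    by rewrite ifF ?pcoordE//; apply/negbTE; rewrite neq_ltn an.
  rewrite an; have [Bw|[w0 [h [h2 wh hW gdw]]]] := collared_inv dw gw.
    exfalso; move: an en; have := core_cell Bw.
    by rewrite cell_atE// => -> /eqP ->; rewrite ltnn.
  (* As [1 - enorm w < h] and [h <= 1 / 2], doubling [w] carries it past the sphere. *)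
  have -> : chi a ((1 + 1) *: w) = chi a (dir w).
    by rewrite -chi_retract retract_disc_out//; lra.
  split=> //; rewrite -ltnS.
  by apply: leq_trans (dim_chi_sphere (dir_sphere w0)) _; rewrite (eqP an).
apply: (push_null f01 fn gE); apply: IHn.
- by move=> t; have [] := gP t.
- by move=> t; have [] := gP t.
- by rewrite !gE f01.
Qed.

Lemma nice_collared : nice R collared.
Proof.
split; [exact: open_collared|exact: collared_path_connected|].
move=> x gx f gf f0 f1; apply/path_classP.
by rewrite -f0; apply: collared_null; rewrite ?f1.
Qed.

End collared.

(** Collar the image of a small ball around the coordinates of [x] in its own cell. *)
Lemma cw_nice_basis {R : realType} {X : topologicalType} (K : cw_complex R X) :
  basis (@nice R X).
Proof.
split=> [U []//|x V].
rewrite nbhsE => -[W [oW Wx] WV].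
case: (pcoordP K x); case: (pcoord K x) => e c /= dc cx.
have : nbhs c (chi e @^-1` W `&` @open_disc R (cw_dim e)).
  apply: filterI; last by apply: open_nbhs_nbhs; split=> //; exact: open_open_disc.
  by apply: chi_continuous; rewrite cx; exact: open_nbhs_nbhs.
move=> /nbhs_ballP[d /= d0 dP].
exists (collared W c d).
  split; first by apply: nice_collared => // w /dP[].
  by apply: collared_core; exists c => //; exact: ballxx.
by apply: subset_trans WV; apply: collared_sub => w /dP[].
Qed.

(** * Products *)

Section path_topology.
Context {R : realType}.
Local Notation I := (unit_interval R).

Lemma unit_interval_hausdorff : hausdorff_space I.
Proof.
move=> s t st; apply: val_inj; apply: Rhausdorff => A B As Bt.
have sA : nbhs s (\val @^-1` A) by exact: unit_val_continuous.
have tB : nbhs t (\val @^-1` B) by exact: unit_val_continuous.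
by have [u [Au Bu]] := st _ _ sA tB; exists (\val u).
Qed.

Lemma unit_interval_regular : regular_space I.
Proof.
move=> t; apply: (compact_regular (V := setT)).
- exact: unit_interval_hausdorff.
- exact: compact_unit_interval.
- exact: filterT.
Qed.

Lemma nbhs_path {X : topologicalType} (K : set I) (O : set X) (f : path_space R X) :
  compact K -> open O -> f @` K `<=` O ->
  nbhs f [set g : path_space R X | g @` K `<=` O].
Proof.
move=> cK oO fO; apply: open_nbhs_nbhs; split=> //.
exists [set g : {compact-open, I -> X} | g @` K `<=` O] => //.
exact: compact_open_open.
Qed.

(** The interval is compact Hausdorff, so [t] has a compact neighbourhood that [f] maps into the
    given open set. *)
Lemma path_eval_continuous {X : topologicalType} :
  continuous (fun z : path_space R X * I => z.1 z.2).
Proof.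
move=> [f t] A /=; rewrite nbhsE => -[Q [oQ Qft] QA].
have /unit_interval_regular[C tC CQ] : nbhs t (f @^-1` Q).
  by apply: path_continuous; exact: open_nbhs_nbhs.
exists ([set g : path_space R X | g @` closure C `<=` Q], closure C).
  split; last by apply: filterS tC; exact: subset_closure.
  apply: nbhs_path => //.
    by apply: subclosed_compact compact_unit_interval _ => //; exact: closed_closure.
  by move=> _ [u /CQ Qu <-].
by move=> [g u] [/= gQ Cu]; apply/QA/gQ; exists u.
Qed.

Lemma cvg_pathP {X T : topologicalType} (s : T -> path_space R X) t :
  (forall K O, compact K -> open O -> s t @` K `<=` O ->
    \forall t' \near t, s t' @` K `<=` O) ->
  {for t, continuous s}.
Proof.
move=> H A; rewrite /= nbhsE => -[B [[C oC CB] Bt] BA].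
have cvgC : (fun t => s t : {compact-open, I -> X}) @ t -->
    (s t : {compact-open, I -> X}).
  by apply/compact_open_cvgP => K O cK oO sO; exact: H.
have : nbhs (s t : {compact-open, I -> X}) C.
  by apply: open_nbhs_nbhs; split=> //; rewrite -CB in Bt.
move=> /cvgC nC; have {}nC : \forall t' \near t, C (s t' : I -> X) by exact: nC.
by apply: filterS nC => t' Ct'; apply: BA; rewrite -CB.
Qed.

End path_topology.

Section pair_path.
Context {R : realType} {X Y : topologicalType}.
Local Notation I := (unit_interval R).
Implicit Types (f : path_space R X) (g : path_space R Y).

Lemma pair_path_continuous f g : continuous (fun t => (f t, g t)).
Proof. by apply: continuous_pair; exact: path_continuous. Qed.

Definition pair_path f g : path_space R (X * Y)%type :=
  mkpath (@pair_path_continuous f g).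

Lemma homotopic_pair f f' g g' : homotopic f f' -> homotopic g g' ->
  homotopic (pair_path f g) (pair_path f' g').
Proof.
move=> [H cH [H0 H1 Hz Ho]] [L cL [L0 L1 Lz Lo]].
exists (fun z => (H z, L z)); first exact: continuous_pair.
by split=> [s|s|t|t]; rewrite ?H0 ?L0 ?H1 ?L1 ?Hz ?Lz ?Ho ?Lo.
Qed.

Definition fst_continuous : continuous (@fst X Y) := fun z => cvg_fst.
Definition snd_continuous : continuous (@snd X Y) := fun z => cvg_snd.

Definition Pi_fst : Pi R (X * Y)%type -> Pi R X := map_Pi fst_continuous.
Definition Pi_snd : Pi R (X * Y)%type -> Pi R Y := map_Pi snd_continuous.

Lemma pair_pathE (h : path_space R (X * Y)%type) :
  homotopic (pair_path (map_path fst_continuous h) (map_path snd_continuous h)) h.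
Proof. by apply: homotopic_eq => t; exact/esym/surjective_pairing. Qed.

Lemma path_class_pair p f g : path_class f = Pi_fst p -> path_class g = Pi_snd p ->
  path_class (pair_path f g) = p.
Proof.
have [h ->] := PiP p; rewrite /Pi_fst /Pi_snd !map_PiE.
move=> /path_classP fh /path_classP gh.
apply/path_classP; apply: homotopic_trans (pair_pathE h).
exact: homotopic_pair.
Qed.

(** An open set of the product need not be a rectangle. Continuity of evaluation gives the condition
    near each [u] in [K], and compactness makes it uniform. *)
Lemma pair_path_cvg {T : topologicalType} (s : T -> path_space R X)
    (s' : T -> path_space R Y) t :
  {for t, continuous s} -> {for t, continuous s'} ->
  {for t, continuous (fun t => pair_path (s t) (s' t))}.
Proof.
move=> cs cs'; apply: cvg_pathP => K O cK oO KO.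
suff : \forall t' \near t, K `<=` (fun u => O (s t' u, s' t' u)).
  by apply: filterS => t' H _ [u Ku <-]; exact: H.
move/compact_near_coveringP : cK; apply => u Ku.
have ev (Z : topologicalType) (r : T -> path_space R Z) (A : set Z) :
    {for t, continuous r} -> nbhs (r t u) A ->
    \forall u' \near u & t' \near t, A (r t' u').
  move=> cr rA; have [[P Q] [/= rP uQ] PQA] := @path_eval_continuous R Z (r t, u) _ rA.
  exists (Q, r @^-1` P); first by split=> //; exact: cr.
  by move=> [u' t'] [/= Qu' Pt']; exact: (PQA (r t', u')).
have [[A B] [/= sA sB] AB] : nbhs (s t u, s' t u) O.
  by apply: open_nbhs_nbhs; split=> //; apply: KO; exists u.
apply: filterS2 (ev _ _ _ cs sA) (ev _ _ _ cs' sB) => -[u' t'] /= Au' Bu'.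
exact: (AB (_, _)).
Qed.

Lemma nice_setX (U : set X) (V : set Y) :
  nice R U -> nice R V -> nice R (U `*` V).
Proof.
move=> [oU pU nU] [oV pV nV]; split.
- rewrite openE => -[x y] [/= Ux Vy]; exists (U, V) => //=.
  by split; exact: open_nbhs_nbhs.
- move=> [x y] [x' y'] [/= Ux Vy] [/= Ux' Vy'].
  have [f [Uf f0 f1]] := pU _ _ Ux Ux'; have [g [Vg g0 g1]] := pV _ _ Vy Vy'.
  exists (pair_path f g); split; first by move=> t; split; [exact: Uf|exact: Vg].
    by rewrite -f0 -g0.
  by rewrite -f1 -g1.
move=> [x y] [/= Ux Vy] h UVh h0 h1.
apply: homotopic_trans (homotopic_sym (pair_pathE h)) _.
apply: (@homotopic_trans _ _ (pair_path (const_path R x) (const_path R y))).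
  apply: homotopic_pair.
    by apply: (nU x) => //; [move=> t; have [] := UVh t| |]; rewrite map_pathE ?h0 ?h1.
  by apply: (nV y) => //; [move=> t; have [] := UVh t| |]; rewrite map_pathE ?h0 ?h1.
exact: homotopic_eq.
Qed.

Lemma nice_basis_prod : basis (@nice R X) -> basis (@nice R Y) ->
  basis (@nice R (X * Y)%type).
Proof.
move=> bX bY; split=> [U []//|[x y] A [[P Q] [/= xP yQ] PQA]].
have [U [nU Ux] UP] := bX.2 x P xP; have [V [nV Vy] VQ] := bY.2 y Q yQ.
exists (U `*` V); first by split; [exact: nice_setX|split].
by move=> [x' y'] [/= /UP Px' /VQ Qy']; exact: PQA.
Qed.

End pair_path.

Lemma map_Pi_continuous {R : realType} {X Y : topologicalType} (h : X -> Y)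
    (ch : continuous h) : basis (@nice R X) -> basis (@nice R Y) ->
  continuous (map_Pi ch : Pi R X -> Pi R Y).
Proof.
move=> bX bY p A; rewrite /= nbhsE => -[W [oW Wp] WA].
have [U [V [nU nV Up Vp UVW]]] := Pi_basic_sub_open bY oW Wp.
rewrite src_map in Up; rewrite tgt_map in Vp.
have hU (U0 : set Y) x : nice R U0 -> U0 (h x) ->
    exists U', [/\ nice R U', U' x & U' `<=` h @^-1` U0].
  move=> [oU _ _] Ux; have [|U' [nU' U'x] U'U] := bX.2 x (h @^-1` U0).
    by apply: (ch x); exact: open_nbhs_nbhs.
  by exists U'.
have [U' [nU' U'p U'U]] := hU _ _ nU Up.
have [V' [nV' V'p V'V]] := hU _ _ nV Vp.
have := open_nbhs_nbhs (Pi_basic_open bX nU' nV' U'p V'p).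
apply: filterS => q /(Pi_basicE _ U'p V'p)[u [v [Uu Vv up vp ->]]].
apply/WA/UVW/Pi_basicE; rewrite ?src_map ?tgt_map//.
exists (map_Pi ch u), (map_Pi ch v); rewrite src_map tgt_map up vp; split=> //.
- exact: inside_map U'U Uu.
- exact: inside_map V'V Vv.
- by rewrite !map_comp ?tgt_comp.
Qed.

(** * Rectangles of dominant products *)

Section rectangles.
Context {R : realType} {I J : finType}.
Implicit Types (a : I -> R) (b : J -> R) (S : {set I}) (T : {set J}).

Definition dominant a b S T := forall i j, i \in S -> j \in T ->
  0 < a i * b j /\ forall i' j', ~~ ((i' \in S) && (j' \in T)) ->
    a i' * b j' < a i * b j.

Let dominant_sub S T S' T' : S != finset.set0 -> T != finset.set0 ->
  {subset [predX S & T] <= [predX S' & T']} -> S \subset S' /\ T \subset T'.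
Proof.
move=> /finset.set0Pn[i0 Si0] /finset.set0Pn[j0 Tj0] H.
split; apply/fintype.subsetP => k Sk.
  by have /andP[] := H (k, j0) (introT andP (conj Sk Tj0)).
by have /andP[] := H (i0, k) (introT andP (conj Si0 Sk)).
Qed.

(** If neither rectangle contained the other, each would hold a product exceeding one in the other,
    in both directions. So they are nested, and equal sums of sizes force equality. *)
Lemma dominant_unique a b S T S' T' : S != finset.set0 -> T != finset.set0 ->
  S' != finset.set0 -> T' != finset.set0 -> dominant a b S T -> dominant a b S' T' ->
  (#|S| + #|T| = #|S'| + #|T'|)%N -> S = S' /\ T = T'.
Proof.
wlog : S T S' T' / {subset [predX S & T] <= [predX S' & T']}.
  move=> Hwlog S0 T0 S'0 T'0 dST dST' c.
  have [HS|HS] := pselect {subset [predX S & T] <= [predX S' & T']}.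
    exact: Hwlog.
  have [HS'|HS'] := pselect {subset [predX S' & T'] <= [predX S & T]}.
    by have [-> ->] := Hwlog S' T' S T HS' S'0 T'0 S0 T0 dST' dST (esym c).
  have ex (A B : pred (I * J)) : ~ {subset A <= B} -> exists x, x \in A /\ x \notin B.
    move=> nAB; apply: contrapT => nx; apply: nAB => x xA; apply: contrapT => xB.
    by apply: nx; exists x; split=> //; exact/negP.
  have [[i j] [/andP[/= Si Tj] nij]] := ex _ _ HS.
  have [[i' j'] [/andP[/= Si' Tj'] nij']] := ex _ _ HS'.
  have [_ /(_ i' j' nij') lt1] := dST i j Si Tj.
  have [_ /(_ i j nij) lt2] := dST' i' j' Si' Tj'.
  by have := lt_trans lt1 lt2; rewrite ltxx.
move=> H S0 T0 S'0 T'0 _ _ c.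
have [SS TT] := dominant_sub S0 T0 H.
have := subset_leq_card SS; have := subset_leq_card TT => lT lS.
split; apply/eqP; rewrite finset.eqEcard ?SS ?TT /=.
  by rewrite -(leq_add2r #|T|) c leq_add2l.
by rewrite -(leq_add2l #|S|) c leq_add2r.
Qed.

(** Take the indices where [a], respectively [b], is maximal; both maxima are positive, so the
    product is largest exactly there. *)
Lemma dominant_argmax a b : (forall i, 0 <= a i) -> (forall j, 0 <= b j) ->
  (exists i, 0 < a i) -> (exists j, 0 < b j) ->
  exists S T, [/\ S != finset.set0, T != finset.set0 & dominant a b S T].
Proof.
move=> a0 b0 [i1 ai1] [j1 bj1].
pose i0 := [arg max_(i > i1) a i]%O; pose j0 := [arg max_(j > j1) b j]%O.
have i0P i : a i <= a i0 by rewrite /i0; case: arg_maxP => // k _; exact.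
have j0P j : b j <= b j0 by rewrite /j0; case: arg_maxP => // k _; exact.
exists [set i | a i == a i0]%SET, [set j | b j == b j0]%SET; split.
- by apply/finset.set0Pn; exists i0; rewrite inE.
- by apply/finset.set0Pn; exists j0; rewrite inE.
have apos : 0 < a i0 by exact: lt_le_trans (i0P i1).
have bpos : 0 < b j0 by exact: lt_le_trans (j0P j1).
move=> i j; rewrite !inE => /eqP -> /eqP ->; split; first exact: mulr_gt0.
move=> i' j'; rewrite !inE negb_and => /orP[ne|ne].
  apply: (@le_lt_trans _ _ (a i' * b j0)); first by rewrite ler_wpM2l.
  by rewrite ltr_pM2r// lt_neqAle ne i0P.
apply: (@le_lt_trans _ _ (a i0 * b j')); first by rewrite ler_wpM2r.
by rewrite ltr_pM2l// lt_neqAle ne j0P.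
Qed.

Lemma dominant_near {Z : topologicalType} (f : I -> Z -> R) (g : J -> Z -> R) S T z :
  (forall i, {for z, continuous (f i)}) -> (forall j, {for z, continuous (g j)}) ->
  dominant (f^~ z) (g^~ z) S T ->
  \forall y \near z, dominant (f^~ y) (g^~ y) S T.
Proof.
move=> cf cg d.
have cfg i j : {for z, continuous (fun y => f i y * g j y)}.
  by apply: continuousM; [exact: cf|exact: cg].
apply: filter_forall => i; apply: filter_forall => j.
have [Si|Si] := boolP (i \in S); last by apply: filterE => y.
have [Tj|Tj] := boolP (j \in T); last by apply: filterE => y.
have [pos dom] := d i j Si Tj.
have npos : \forall y \near z, 0 < f i y * g j y.
  exact: (cvgr_gt _ (cfg i j)).
have ndom : \forall y \near z, forall i' j', ~~ ((i' \in S) && (j' \in T)) ->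
    f i' y * g j' y < f i y * g j y.
  apply: filter_forall => i'; apply: filter_forall => j'.
  have [_|H] := boolP ((i' \in S) && (j' \in T)); first by apply: filterE.
  have : 0 < f i z * g j z - f i' z * g j' z by rewrite subr_gt0 dom.
  have cB : {for z, continuous (fun y => f i y * g j y - f i' y * g j' y)}.
    by apply: continuousB; exact: cfg.
  move=> /(cvgr_gt _ cB _); apply: filterS => y; rewrite subr_gt0.
  by [].
by apply: filterS2 npos ndom => y py dy _ _; split.
Qed.

End rectangles.

(** * Local sections over the product *)

Section product.
Context {R : realType} {X Y : topologicalType}.
Hypothesis nice_X : basis (@nice R X).
Hypothesis nice_Y : basis (@nice R Y).

Let cozero_sets (Z : topologicalType) := forall W : set Z, open W ->
  exists f : Z -> R, [/\ continuous f, forall z, 0 <= f z &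
    forall z, 0 < f z <-> W z].

Hypothesis cozero_X : cozero_sets (Pi R X).
Hypothesis cozero_Y : cozero_sets (Pi R Y).

Let local_sections_data (Z : topologicalType) k :
  cozero_sets (Pi R Z) -> local_sections R Z k ->
  exists (U : 'I_k.+1 -> set (Pi R Z)) (f : 'I_k.+1 -> Pi R Z -> R)
    (s : 'I_k.+1 -> Pi R Z -> path_space R Z),
  [/\ \bigcup_j U j = setT, forall j, continuous (f j), forall j p, 0 <= f j p,
      forall j p, 0 < f j p <-> U j p &
      forall j p, U j p -> {for p, continuous (s j)} /\ path_class (s j p) = p].
Proof.
move=> cZ [U [UT HU]].
have /choice[f fP] : forall j, exists f : Pi R Z -> R,
    [/\ continuous f, forall z, 0 <= f z & forall z, 0 < f z <-> U j z].
  by move=> j; have [oU _] := HU j; exact: cZ.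
have /choice[s sP] : forall j, exists s : Pi R Z -> path_space R Z,
    forall p, U j p -> {for p, continuous s} /\ path_class (s p) = p.
  move=> j; have [oU [s cs sU]] := HU j; exists s => p Up; split; last exact: sU.
  by move: cs; rewrite continuous_open_subspace// => /(_ p (mem_set Up)).
by exists U, f, s; split=> // j; have [] := fP j.
Qed.

Lemma local_sections_prod n m : local_sections R X n -> local_sections R Y m ->
  local_sections R (X * Y)%type (n + m).
Proof.
move=> /(local_sections_data cozero_X)[U [f [s [UT cf f0 fU sP]]]].
move=> /(local_sections_data cozero_Y)[V [g [t [VT cg g0 gV tP]]]].
pose a i (p : Pi R (X * Y)%type) := f i (Pi_fst p).
pose b j (p : Pi R (X * Y)%type) := g j (Pi_snd p).
have nice_XY := nice_basis_prod nice_X nice_Y.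
have cfst : continuous (@Pi_fst R X Y) by exact: map_Pi_continuous.
have csnd : continuous (@Pi_snd R X Y) by exact: map_Pi_continuous.
have ca i : continuous (a i).
  by move=> p; apply: continuous_comp; [exact: cfst|exact: cf].
have cb j : continuous (b j).
  by move=> p; apply: continuous_comp; [exact: csnd|exact: cg].
(* The shift by two reflects that nonempty [S] and [T] have sizes adding up to at least 2. *)
pose piece (k : nat) (ST : {set 'I_n.+1} * {set 'I_m.+1}) p :=
  [/\ ST.1 != finset.set0, ST.2 != finset.set0, (#|ST.1| + #|ST.2| = k.+2)%N &
      dominant (a^~ p) (b^~ p) ST.1 ST.2].
have piece_unique k ST ST' p : piece k ST p -> piece k ST' p -> ST = ST'.
  case: ST ST' => [S T] [S' T'] [/= S0 T0 c d] [/= S0' T0' c' d'].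
  by have [|-> ->] := dominant_unique S0 T0 S0' T0' d d'; rewrite ?c.
have piece_near k ST p : piece k ST p -> \forall q \near p, piece k ST q.
  move=> [S0 T0 c d].
  have := dominant_near (fun i => @ca i p) (fun j => @cb j p) d.
  by apply: filterS => q dq; split.
(* All products in a dominant rectangle are positive, so any [i] and [j] in it give sections defined
   at [p]; [repr p] is the default for empty sets. *)
pose sec (ST : {set 'I_n.+1} * {set 'I_m.+1}) p :=
  if [pick i in ST.1] is Some i then
    if [pick j in ST.2] is Some j then
      pair_path (s i (Pi_fst p)) (t j (Pi_snd p))
    else repr p else repr p.
have secP k ST p : piece k ST p ->
    {for p, continuous (sec ST)} /\ path_class (sec ST p) = p.
  move=> [/finset.set0Pn[i1 Si1] /finset.set0Pn[j1 Tj1] _ d]; rewrite /sec.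
  case: pickP => [i Si|/(_ i1)]; last by rewrite Si1.
  case: pickP => [j Tj|/(_ j1)]; last by rewrite Tj1.
  have [abpos _] := d i j Si Tj.
  have apos : 0 < a i p.
    by rewrite lt_neqAle f0 andbT; apply: contraTneq abpos => <-; rewrite mul0r ltxx.
  have bpos : 0 < b j p by move: abpos; rewrite pmulr_rgt0.
  have [cs sE] := sP i _ ((fU i _).1 apos).
  have [ct tE] := tP j _ ((gV j _).1 bpos).
  split; last exact: path_class_pair.
  apply: pair_path_cvg.
    by apply: (@continuous_comp _ _ _ (@Pi_fst R X Y) (s i)); [exact: cfst|exact: cs].
  by apply: (@continuous_comp _ _ _ (@Pi_snd R X Y) (t j)); [exact: csnd|exact: ct].
exists (fun k : 'I_(n + m).+1 => [set p | exists ST, piece k ST p]); split.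
  apply/seteqP; split=> // p _.
  have [i _ Ui] : (\bigcup_j U j) (Pi_fst p) by rewrite UT.
  have [j _ Vj] : (\bigcup_j V j) (Pi_snd p) by rewrite VT.
  have [||||S [T [S0 T0 d]]] := @dominant_argmax _ _ _ (a^~ p) (b^~ p).
  - by move=> i'; exact: f0.
  - by move=> j'; exact: g0.
  - by exists i; exact/fU.
  - by exists j; exact/gV.
  have S1 : (0 < #|S|)%N by rewrite finset.card_gt0.
  have T1 : (0 < #|T|)%N by rewrite finset.card_gt0.
  have Sn : (#|S| <= n.+1)%N by rewrite -[X in (_ <= X)%N]card_ord max_card.
  have Tm : (#|T| <= m.+1)%N by rewrite -[X in (_ <= X)%N]card_ord max_card.
  have kP : ((#|S| + #|T|).-2 < (n + m).+1)%N.
    rewrite -(prednK S1) -(prednK T1) addSn addnS /= ltnS.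
    by apply: leq_add; rewrite -ltnS prednK.
  exists (Ordinal kP) => //; exists (S, T); split=> //=.
  by rewrite -(prednK S1) -(prednK T1) addSn addnS.
move=> k; have oW : open [set p | exists ST, piece k ST p].
  rewrite openE => p [ST pST]; apply: filterS (piece_near _ _ _ pST) => q qST.
  by exists ST.
split=> //.
(* The rectangle of a point is unique and locally constant, so continuity is inherited from
   [sec ST]. *)
exists (fun p =>
  if [pick ST | `[< piece k ST p >]] is Some ST then sec ST p else repr p).
  rewrite continuous_open_subspace// => p /set_mem[ST pST].
  have pickE q : piece k ST q -> [pick ST | `[< piece k ST q >]] = Some ST.
    move=> qST; case: pickP => [ST' /asboolP qST'|/(_ ST)/asboolP//].
    by rewrite (piece_unique _ _ _ _ qST' qST).
  have [cST _] := secP _ _ _ pST.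
  move=> A; rewrite /= pickE// => /cST nA.
  have {}nA : \forall q \near p, A (sec ST q) by exact: nA.
  by apply: filterS2 (piece_near _ _ _ pST) nA => q qST Aq; rewrite /= pickE.
move=> p [ST pST]; case: pickP => [ST' /asboolP pST'|/(_ ST)/asboolP//].
by have [] := secP _ _ _ pST'.
Qed.

End product.

Lemma cw_cozero {R : realType} {X : topologicalType} (K : cw_complex R X)
    (W : set (Pi R X)) : open W ->
  exists f : Pi R X -> R, [/\ continuous f, forall p, 0 <= f p &
    forall p, 0 < f p <-> W p].
Proof.
move=> oW; have nX := cw_nice_basis K.
exists (cozero_fun K W); split; first exact: cozero_continuous.
- exact: cozero_ge0.
- by move=> p; exact: cozero_gt0.
Qed.

(** A nonempty set of natural numbers has a least element; a finite complexity thus comes with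
    actual local sections to be paired. *)
Lemma asphericity_complexity_attained {R : realType} {X : topologicalType} :
  (asphericity_complexity R X = +oo)%E \/
  exists2 n, local_sections R X n & asphericity_complexity R X = (n%:R%:E)%E.
Proof.
have [H|H] := pselect (exists n, local_sections R X n); last first.
  left; rewrite /asphericity_complexity (_ : [set _ | _ in _] = set0) ?ereal_inf0//.
  by apply/seteqP; split=> // x [n Hn _]; case: H; exists n.
right; have Hb : exists n, `[< local_sections R X n >].
  by have [n Hn] := H; exists n; exact/asboolP.
case: (ex_minnP Hb) => n /asboolP Hn nmin; exists n => //.
apply/eqP; rewrite eq_le; apply/andP; split.
  by apply: ereal_inf_lbound; exists n.
apply/ereal_infP => _ [k Hk <-]; rewrite lee_fin ler_nat.
by apply: nmin; exact/asboolP.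
Qed.

Local Close Scope ring_scope.
Local Open Scope ereal_scope.

Theorem proposition6p11 (R : realType) (X Y : topologicalType)
    (KX : cw_complex R X) (KY : cw_complex R Y)
    (hX : connected [set: X]) (hY : connected [set: Y])
    (fX : locally_finite_cw KX \/ countable_cw KX)
    (fY : locally_finite_cw KY \/ countable_cw KY) :
  asphericity_complexity R (X * Y)%type <=
    asphericity_complexity R X + asphericity_complexity R Y.
Proof.
(* Excludes the value [-oo], so that adding it to [+oo] gives [+oo]. *)
have AC_ge0 (Z : topologicalType) : 0 <= asphericity_complexity R Z.
  by apply/ereal_infP => _ [k _ <-]; rewrite lee_fin ler0n.
have [->|[n nX ->]] := @asphericity_complexity_attained R X.
  by rewrite addye ?leey// gt_eqF// (lt_le_trans _ (AC_ge0 Y))// ltNy0.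
have [->|[m mY ->]] := @asphericity_complexity_attained R Y.
  by rewrite addey ?leey.
rewrite -EFinD -natrD; apply: ereal_inf_lbound; exists (n + m)%N => //.
apply: local_sections_prod => //; try exact: cw_nice_basis.
- exact: cw_cozero.
- exact: cw_cozero.
Qed.
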